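(* Let $\chi$ be a Dirichlet character modulo $m$, and let $\chi_1$ be the primitive character of conductor $m_1$ inducing $\chi$. Write $\chi(-1)=(-1)^a$ with $a\in\{0,1\}$. Then, for every integer $n\ge1$ with $n\equiv a\pmod 2$, $$\frac{L_\chi(n+1)}{\pi^n}$$ is an exponential period over the field $\mathbb{Q}(\chi,\zeta_{4m_1})(t,e^{-t})$, where $\zeta_{4m_1}$ is a primitive $4m_1$-th root of unity.
   Context: $L_\chi(s)=\sum_{k\ge1}\chi(k)k^{-s}$ for $\Re s>1$. $\mathbb{Q}(\chi,\zeta_{4m_1})$ is the subfield of $\mathbb{C}$ generated over $\mathbb{Q}$ by the values of $\chi$ and $\zeta_{4m_1}$, and $\mathbb{Q}(\chi,\zeta_{4m_1})(t,e^{-t})$ is the field of meromorphic functions of $t$ generated over it by $t$ and $e^{-t}$. A complex number is an exponential period over a field $\mathbb{F}$ of meromorphic functions of $t$ if it equals a convergent integral $\int_0^{+\infty}f(t)\,dt$ with $f\in\mathbb{F}$. *)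

(* Defs.v *)
From Stdlib Require Import Reals ZArith Arith.
From Coquelicot Require Import Coquelicot.

Open Scope C_scope.

(** * Dirichlet characters *)

(** Characters are defined on all of [Z], extended by [0] to the integers not
    coprime to [m], so that [chi (-1)] makes sense. *)
Record DirichletChar (m : nat) : Type := {
  dchar :> Z -> C;
  dchar_pos : (0 < m)%nat;
  dchar_mult : forall j k : Z, dchar (j * k)%Z = dchar j * dchar k;
  dchar_periodic : forall k : Z, dchar (k + Z.of_nat m)%Z = dchar k;
  dchar_supp : forall k : Z, dchar k <> 0 <-> Z.gcd k (Z.of_nat m) = 1%Z
}.

Definition induces {d m : nat} (psi : DirichletChar d) (chi : DirichletChar m)
  : Prop :=
  Nat.divide d m /\
  forall k : Z, Z.gcd k (Z.of_nat m) = 1%Z -> chi k = psi k.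

(** [chi] modulo [m] is primitive when its conductor is [m] itself. *)
Definition is_primitive {m : nat} (chi : DirichletChar m) : Prop :=
  forall (d : nat) (psi : DirichletChar d), induces psi chi -> d = m.

(** * L-series *)

Definition Cexp (z : C) : C :=
  (exp (Re z) * cos (Im z), exp (Re z) * sin (Im z))%R.

Definition CSeries (a : nat -> C) : C :=
  (Series (fun k => Re (a k)), Series (fun k => Im (a k))).

Lemma CSeries_unique (a : nat -> C) (l : C) :
  is_series (V := C_R_NormedModule) a l -> CSeries a = l.
Proof.
intros H.
assert (Hc : forall N, sum_n (G := C_R_NormedModule) a N =
  (sum_n (fun k => Re (a k)) N, sum_n (fun k => Im (a k)) N)).
{ induction N as [|N IH].
  - rewrite !sum_O; destruct (a 0%nat); reflexivity.
  - rewrite !sum_Sn, IH; reflexivity. }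
destruct l as [x y]; unfold CSeries; f_equal; apply is_series_unique.
- intros P [eps HP]; destruct (H (fun z => P (Re z))) as [N HN].
  + exists eps; intros z [Hz _]; exact (HP _ Hz).
  + exists N; intros k Hk; generalize (HN k Hk); rewrite Hc; exact (fun h => h).
- intros P [eps HP]; destruct (H (fun z => P (Im z))) as [N HN].
  + exists eps; intros z [_ Hz]; exact (HP _ Hz).
  + exists N; intros k Hk; generalize (HN k Hk); rewrite Hc; exact (fun h => h).
Qed.

(** [sum_(k >= 1) chi(k) k^(-s)] with [k^(-s) = exp (- s ln k)]; the summation
    index is shifted by one.  Meaningful for [1 < Re s]. *)
Definition L_series {m : nat} (chi : DirichletChar m) (s : C) : C :=
  CSeries (fun k : nat => chi (Z.of_nat (S k)) * Cexp (- s * ln (INR (S k)))).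

(** * Generated fields *)

Definition primitive_root_of_unity (N : nat) (z : C) : Prop :=
  z ^ N = 1 /\ forall k : nat, (0 < k < N)%nat -> z ^ k <> 1.

(** The subfield of [C] generated over the rationals by [S]. *)
Inductive subfield_gen (S : C -> Prop) : C -> Prop :=
| sfg_mem z : S z -> subfield_gen S z
| sfg_one : subfield_gen S 1
| sfg_add z w : subfield_gen S z -> subfield_gen S w -> subfield_gen S (z + w)
| sfg_opp z : subfield_gen S z -> subfield_gen S (- z)
| sfg_mul z w : subfield_gen S z -> subfield_gen S w -> subfield_gen S (z * w)
| sfg_inv z : z <> 0 -> subfield_gen S z -> subfield_gen S (/ z).

(** A meromorphic function on the plane is represented by a total function
    [C -> C] with arbitrary values at its poles; two representatives stand for
    the same meromorphic function when they agree off a closed discrete set. *)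
Definition mero_eq (f g : C -> C) : Prop :=
  forall z : C, locally' z (fun w : C => f w = g w).

(** The field of meromorphic functions [K(t, e^(-t))]. *)
Inductive mero_field_gen (K : C -> Prop) : (C -> C) -> Prop :=
| mfg_const c : K c -> mero_field_gen K (fun _ => c)
| mfg_var : mero_field_gen K (fun t => t)
| mfg_exp : mero_field_gen K (fun t => Cexp (- t))
| mfg_add f g : mero_field_gen K f -> mero_field_gen K g ->
    mero_field_gen K (fun t => f t + g t)
| mfg_opp f : mero_field_gen K f -> mero_field_gen K (fun t => - f t)
| mfg_mul f g : mero_field_gen K f -> mero_field_gen K g ->
    mero_field_gen K (fun t => f t * g t)
| mfg_inv f : ~ mero_eq f (fun _ => 0) -> mero_field_gen K f ->
    mero_field_gen K (fun t => / f t)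
| mfg_ext f g : mero_eq f g -> mero_field_gen K f -> mero_field_gen K g.

(** * Exponential periods *)

(** The improper Riemann integral is insensitive to the values of a
    representative on a discrete set, and it rules out poles in
    the open half-line, so it depends only on the meromorphic function. *)
Definition exponential_period (F : (C -> C) -> Prop) (x : C) : Prop :=
  exists f : C -> C, F f /\
    is_RInt_gen (V := C_R_NormedModule) (fun t : R => f (RtoC t))
      (at_right 0) (Rbar_locally p_infty) x.

(* Main.v *)
(** The Taylor-subtracted generating function of [chi1] has an explicit partial
    fraction expansion.  Put [a_j = 2 pi j] and let [psi] be [cos] or [sin]
    according to the parity of [n].  For [x = p / M] with [M = m1],
    [pf t = sum_(j >= 1) psi(a_j x) / (a_j^n (t^2 + a_j^2))]
    is, up to Taylor coefficients at [0] and powers of [t], a combination of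
    [exp (x t) / (exp t - 1)] and [exp ((1 - x) t) / (exp t - 1)], so [pf (M t)]
    lies in the field generated by [t] and [exp (- t)]; the Taylor coefficients
    are rational because [pf] is bounded at [0].  Termwise integration gives
    [int_0^oo pf = (pi / 2) sum_j psi(a_j x) / a_j^(n+1)], a rational multiple of
    [pi^(-n) sum_j psi(a_j x) / j^(n+1)].  The values of [chi1] are combinations of
    the [psi(a_j p / M)] with coefficients in the constant field (discrete Fourier
    transform), and [L_chi] differs from [L_chi1] by finitely many Euler factors.
    The expansion itself is the limit, by Tannery's theorem, of the decomposition of
    [z^rho / (z^N - 1)] into partial fractions at the [N]-th roots of unity. *)

Require Import Defs.
From Stdlib Require Import Reals ZArith Arith Lra Lia List Znumtheory Classical.
From Coquelicot Require Import Coquelicot.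
Local Open Scope R_scope.

(** * Finite sums *)

(** The main obstacle is that constants arising as infinite real series (limits at [0], Taylor
    coefficients) must be shown to lie in the field of constants. They are never evaluated: a
    function is carried along with a power series whose coefficients lie in that field, and a limit
    at [0+] must be the coefficient of index [0]. The series at hand have poles on the imaginary
    axis, so they are multiplied by [(exp t - 1) / t], whose simple zeros are exactly these points;
    no quotient of power series is then ever formed. The expansion at [x] mixes cosines and sines;
    comparison with [1 - x] separates them, and a character of the parity of [n] needs only one
    kind. In the finite expansion [N] is odd, so that [1] is the only real root of unity and all
    others pair off. Working with [chi1] keeps the angles multiples of [2 PI / m1], at the price of
    having to recognise the values of [chi1] among those of [chi]. *)

Fixpoint rsum (f : nat -> R) (n : nat) : R :=
  match n with O => 0 | S k => rsum f k + f (S k) end.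

Lemma rsum_ext_loc f g n :
  (forall k, (1 <= k <= n)%nat -> f k = g k) -> rsum f n = rsum g n.
Proof.
induction n as [|n IH]; intros H; simpl; [reflexivity|].
rewrite IH by (intros; apply H; lia); rewrite H by lia; reflexivity.
Qed.

Lemma rsum_plus f g n : rsum (fun k => f k + g k) n = rsum f n + rsum g n.
Proof. induction n as [|n IH]; simpl; [ring|]. rewrite IH; ring. Qed.

Lemma rsum_scal c f n : rsum (fun k => c * f k) n = c * rsum f n.
Proof. induction n as [|n IH]; simpl; [ring|]. rewrite IH; ring. Qed.

Lemma rsum_zero n : rsum (fun _ => 0) n = 0.
Proof. induction n as [|n IH]; simpl; [ring|]. rewrite IH; ring. Qed.

Lemma rsum_switch (f : nat -> nat -> R) m n :
  rsum (fun j => rsum (f j) n) m = rsum (fun k => rsum (fun j => f j k) m) n.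
Proof.
induction m as [|m IH]; simpl.
- symmetry; apply rsum_zero.
- rewrite IH, <- rsum_plus; reflexivity.
Qed.

Lemma rsum_single f n k0 :
  (1 <= k0 <= n)%nat -> (forall k, (1 <= k <= n)%nat -> k <> k0 -> f k = 0) ->
  rsum f n = f k0.
Proof.
intros Hk H.
rewrite (rsum_ext_loc f (fun k => if Nat.eq_dec k k0 then f k0 else 0)).
- clear H; induction n as [|n IH]; [lia|]; cbn [rsum].
  destruct (Nat.eq_dec (S n) k0) as [<-|Hne].
  + rewrite (rsum_ext_loc _ (fun _ => 0)).
    * rewrite rsum_zero; ring.
    * intros k ?; destruct (Nat.eq_dec k (S n)); [lia|reflexivity].
  + rewrite IH by lia; ring.
- intros k ?; destruct (Nat.eq_dec k k0) as [->|]; [reflexivity|]; auto.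
Qed.

(** * Finite orthogonality relations *)

Lemma cos_add_2PI_Z (x : R) (k : Z) : cos (x + 2 * IZR k * PI) = cos x.
Proof.
destruct (Z_le_gt_dec 0 k) as [Hk|Hk].
- rewrite <- (Z2Nat.id k), <- INR_IZR_INZ by lia; apply cos_period.
- rewrite <- (cos_period _ (Z.to_nat (- k))); f_equal.
  rewrite INR_IZR_INZ, Z2Nat.id by lia; rewrite opp_IZR; ring.
Qed.

Lemma sin_add_2PI_Z (x : R) (k : Z) : sin (x + 2 * IZR k * PI) = sin x.
Proof.
destruct (Z_le_gt_dec 0 k) as [Hk|Hk].
- rewrite <- (Z2Nat.id k), <- INR_IZR_INZ by lia; apply sin_period.
- rewrite <- (sin_period _ (Z.to_nat (- k))); f_equal.
  rewrite INR_IZR_INZ, Z2Nat.id by lia; rewrite opp_IZR; ring.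
Qed.

(** Telescoping of [2 sin (y/2) cos (k y) = sin (k y + y/2) - sin (k y - y/2)]. *)
Lemma dirichlet_kernel (y : R) (n : nat) :
  2 * sin (y / 2) * rsum (fun k => cos (INR k * y)) n =
  sin (INR n * y + y / 2) - sin (y / 2).
Proof.
induction n as [|n IH].
- simpl; rewrite Rmult_0_l, Rplus_0_l; ring.
- cbn [rsum]; rewrite Rmult_plus_distr_l, IH, S_INR.
  replace (INR n * y + y / 2) with ((INR n + 1) * y - y / 2) by field.
  rewrite sin_minus, sin_plus; ring.
Qed.

Lemma sin_PI_mult_neq_0 (N : nat) (d : Z) :
  (0 < N)%nat -> ~ (Z.of_nat N | d)%Z -> sin (IZR d * PI / INR N) <> 0.
Proof.
intros HN Hd H; apply Hd.
destruct (sin_eq_0_0 _ H) as [k Hk]; exists k.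
apply lt_INR in HN; simpl in HN.
apply eq_IZR; rewrite mult_IZR, <- INR_IZR_INZ.
pose proof PI_RGT_0.
apply (Rmult_eq_reg_r (PI / INR N)); [|apply Rgt_not_eq, Rdiv_lt_0_compat; lra].
replace (IZR d * (PI / INR N)) with (IZR d * PI / INR N) by (field; lra).
rewrite Hk; field; lra.
Qed.

Lemma rsum_const c n : rsum (fun _ => c) n = INR n * c.
Proof.
induction n as [|n IH]; [simpl; ring|]. cbn [rsum]. rewrite IH, S_INR; ring.
Qed.

Lemma sum_cos_full (M : nat) (d : Z) :
  (0 < M)%nat ->
  rsum (fun p => cos (INR p * (2 * PI * IZR d / INR M))) M =
  if Zdivide_dec (Z.of_nat M) d then INR M else 0.
Proof.
intros HM; assert (HM' := lt_INR _ _ HM); simpl in HM'.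
destruct (Zdivide_dec (Z.of_nat M) d) as [[k ->]|Hd].
- rewrite (rsum_ext_loc _ (fun _ => 1)); [rewrite rsum_const; ring|].
  intros p _; rewrite mult_IZR, <- INR_IZR_INZ.
  rewrite <- cos_0, <- (cos_add_2PI_Z 0 (Z.of_nat p * k)); f_equal.
  rewrite mult_IZR, <- INR_IZR_INZ; field; lra.
- assert (Hs := sin_PI_mult_neq_0 M d HM Hd).
  assert (H := dirichlet_kernel (2 * PI * IZR d / INR M) M).
  replace (2 * PI * IZR d / INR M / 2) with (IZR d * PI / INR M) in H
    by (field; lra).
  replace (INR M * (2 * PI * IZR d / INR M) + IZR d * PI / INR M)
    with (IZR d * PI / INR M + 2 * IZR d * PI) in H by (field; lra).
  rewrite sin_add_2PI_Z in H; nra.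
Qed.

Lemma sum_cos_half (h s : nat) :
  2 * rsum (fun j => cos (INR j * (2 * PI * INR s / INR (2 * h + 1)))) h =
  (if Nat.eq_dec (s mod (2 * h + 1)) 0 then INR (2 * h + 1) else 0) - 1.
Proof.
set (N := (2 * h + 1)%nat); assert (HN : (0 < N)%nat) by lia.
assert (HN' := lt_INR _ _ HN); simpl in HN'.
assert (HNh : INR N = 2 * INR h + 1).
{ unfold N; rewrite plus_INR, mult_INR; simpl; ring. }
destruct (Nat.eq_dec (s mod N) 0) as [Hs|Hs].
- apply Nat.Lcm0.mod_divide in Hs; destruct Hs as [k ->].
  rewrite (rsum_ext_loc _ (fun _ => 1)); [rewrite rsum_const; lra|].
  intros p _; rewrite mult_INR, <- cos_0, <- (cos_period 0 (p * k)); f_equal.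
  rewrite mult_INR; field; lra.
- assert (Hd : ~ (Z.of_nat N | Z.of_nat s)%Z).
  { intros [k Hk]; apply Hs; apply Nat.Lcm0.mod_divide.
    exists (Z.to_nat k); nia. }
  assert (H0 := sin_PI_mult_neq_0 N _ HN Hd).
  assert (H := dirichlet_kernel (2 * PI * INR s / INR N) h).
  rewrite <- INR_IZR_INZ in H0.
  replace (2 * PI * INR s / INR N / 2) with (INR s * PI / INR N) in H
    by (field; lra).
  (* As [N = 2 h + 1], the argument [(h + 1/2) y] is exactly [PI s], where the sine vanishes. What
     remains is [-1], the opposite of the missing term [j = 0]. *)
  replace (INR h * (2 * PI * INR s / INR N) + INR s * PI / INR N)
    with (IZR (Z.of_nat s) * PI) in H
    by (rewrite <- INR_IZR_INZ, HNh; rewrite HNh in HN'; field; lra).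
  rewrite (sin_eq_0_1 (IZR (Z.of_nat s) * PI)) in H by (eexists; reflexivity).
  nra.
Qed.

(** * A finite partial fraction expansion *)

Lemma geometric_cos (y theta rho : R) (n : nat) :
  (1 - 2 * y * cos theta + y ^ 2) *
    rsum (fun k => y ^ k * cos ((rho + INR k) * theta)) n =
  y * cos ((rho + 1) * theta) - y ^ 2 * cos (rho * theta) -
  y ^ n * (y * cos ((rho + INR n + 1) * theta) -
           y ^ 2 * cos ((rho + INR n) * theta)).
Proof.
induction n as [|n IH].
- simpl; rewrite !Rplus_0_r; ring.
- cbn [rsum]; rewrite Rmult_plus_distr_l, IH, S_INR.
  set (b := (rho + (INR n + 1)) * theta).
  replace ((rho + INR n) * theta) with (b - theta) by (unfold b; ring).
  replace ((rho + (INR n + 1) + 1) * theta) with (b + theta) by (unfold b; ring).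
  replace ((rho + INR n + 1) * theta) with b by (unfold b; ring).
  rewrite cos_plus, cos_minus; simpl; ring.
Qed.

Lemma rsum_pow (y : R) n : y <> 1 ->
  rsum (fun k => y ^ k) n = y * (1 - y ^ n) / (1 - y).
Proof.
intros Hy; induction n as [|n IH]; [simpl; field; lra|].
cbn [rsum]; rewrite IH; simpl; field; lra.
Qed.

(* The summand is twice the real part of [zeta^(rho+1) / (z - zeta)] for [z = 1/y] and
   [zeta = exp (i theta)], split into its value at [z = 1] and a remainder. *)
Lemma finite_partial_fractions (h rho : nat) (y : R) :
  0 < y < 1 -> (rho <= 2 * h)%nat ->
  let N := (2 * h + 1)%nat in
  rsum (fun j =>
    let theta := 2 * PI * INR j / INR N in
    let s := sin ((INR rho + / 2) * theta) in
    let c := cos (INR rho * theta) in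
    let sg := sin (theta / 2) in
    2 * (- (s / (2 * sg)) +
      (1 - y) * ((1 - y) * (s / (2 * sg)) + y * c) /
        ((1 - y) ^ 2 + 4 * y * sg ^ 2))) h =
  INR N * y ^ (N - rho) / (1 - y ^ N) - y / (1 - y).
Proof.
intros Hy Hrho N.
assert (HN : (0 < N)%nat) by lia.
assert (HN' := lt_INR _ _ HN); simpl in HN'.
assert (HyN : y ^ N < 1) by (apply pow_lt_1_compat; [lra|lia]).
apply (Rmult_eq_reg_l (1 - y ^ N)); [|lra].
rewrite <- rsum_scal.
(* The factor [1 - y ^ N] turns each fraction into a finite geometric sum, because the cosines have
   period [N] in [k]. After exchanging the two sums, orthogonality singles out the one [k] in [1..N]
   with [N] dividing [rho + k]. *)
transitivity (rsum (fun j => rsum (fun k =>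
   2 * (y ^ k * cos ((INR rho + INR k) * (2 * PI * INR j / INR N)))) N) h).
- apply rsum_ext_loc; intros j Hj; cbv zeta; rewrite rsum_scal.
  set (theta := 2 * PI * INR j / INR N).
  assert (G := geometric_cos y theta (INR rho) N).
  assert (Hth : forall u, cos ((u + INR N) * theta) = cos (u * theta)).
  { intros u; rewrite <- (cos_period (u * theta) j); f_equal; unfold theta; field; lra. }
  replace (INR rho + INR N + 1) with ((INR rho + 1) + INR N) in G by ring.
  rewrite !Hth in G.
  set (T := rsum _ N) in *.
  set (al := (INR rho + / 2) * theta).
  set (be := theta / 2).
  replace ((INR rho + 1) * theta) with (al + be) in G
    by (unfold al, be; field).
  replace (INR rho * theta) with (al - be) in * by (unfold al, be; field).
  replace theta with (2 * be) in G by (unfold be; field).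
  rewrite cos_2a_sin, cos_plus, cos_minus in G.
  rewrite cos_minus.
  assert (Hsb : sin be <> 0).
  { replace be with (IZR (Z.of_nat j) * PI / INR N)
      by (rewrite <- INR_IZR_INZ; unfold be, theta; field; lra).
    apply sin_PI_mult_neq_0; [exact HN|].
    intros Hd; apply Z.divide_pos_le in Hd; lia. }
  assert (HE : 0 < (1 - y) ^ 2 + 4 * y * sin be ^ 2).
  { assert (0 < (1 - y) ^ 2) by (apply pow_lt; lra).
    assert (0 <= sin be ^ 2) by apply pow2_ge_0; nra. }
  apply (Rmult_eq_reg_l ((1 - y) ^ 2 + 4 * y * sin be ^ 2)); [|lra].
  transitivity (2 * ((1 - 2 * y * (1 - 2 * sin be * sin be) + y ^ 2) * T));
    [|ring].
  rewrite G; field; split; [exact Hsb|apply Rgt_not_eq, HE].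
- rewrite rsum_switch.
  (* The term [- y ^ k] is due to the root [1], that is [j = 0], which the sum leaves out; it
     produces [- y / (1 - y)]. *)
  rewrite (rsum_ext_loc _ (fun k =>
    y ^ k * (if Nat.eq_dec k (N - rho) then INR N else 0) + (-1) * y ^ k)).
  + rewrite rsum_plus, rsum_scal, rsum_pow by lra.
    rewrite (rsum_single _ _ (N - rho)); [|lia|].
    2: { intros k _ Hk; destruct (Nat.eq_dec k (N - rho)); [lia|ring]. }
    destruct (Nat.eq_dec (N - rho) (N - rho)); [|lia].
    field; split; lra.
  + intros k Hk.
    rewrite (rsum_ext_loc _ (fun j => y ^ k * 2 *
       cos (INR j * (2 * PI * INR (rho + k) / INR N)))).
    * rewrite rsum_scal, Rmult_assoc; unfold N; rewrite sum_cos_half; fold N.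
      destruct (Nat.eq_dec ((rho + k) mod N) 0) as [H0|H0];
      destruct (Nat.eq_dec k (N - rho)) as [H1|H1]; try ring; exfalso.
      -- apply Nat.Lcm0.mod_divide in H0; destruct H0 as [q Hq].
         assert (q < 2)%nat by nia. assert (0 < q)%nat by nia.
         apply H1; nia.
      -- apply H0; replace (rho + k)%nat with N by lia.
         apply Nat.Div0.mod_same.
    * intros j _; rewrite plus_INR, <- Rmult_assoc, (Rmult_comm 2 (y ^ k)).
      do 2 f_equal; field; lra.
Qed.

(** * Series and limits *)

Lemma ex_series_bound (a b : nat -> R) :
  (forall n, Rabs (a n) <= b n) -> ex_series b -> ex_series a.
Proof. exact (ex_series_le (K := R_AbsRing) (V := R_CompleteNormedModule) a b). Qed.

Lemma Rabs_Series_le (a b : nat -> R) :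
  (forall n, Rabs (a n) <= b n) -> ex_series b -> Rabs (Series a) <= Series b.
Proof.
intros H Hb.
assert (Ha : ex_series (fun n => Rabs (a n))).
{ apply ex_series_bound with b; [|exact Hb].
  intros n; rewrite Rabs_Rabsolu; apply H. }
apply Rle_trans with (1 := Series_Rabs _ Ha).
apply Series_le; [|exact Hb]; intros n; split; [apply Rabs_pos|apply H].
Qed.

Lemma ex_series_inv_sq : ex_series (fun n => / INR (S n) ^ 2).
Proof.
apply (ex_series_bound _ (fun n => 2 * (/ INR (S n) - / INR (S (S n))))).
- intros n; assert (H := lt_0_INR (S n) ltac:(lia)).
  rewrite (S_INR (S n)), Rabs_pos_eq by (left; apply Rinv_0_lt_compat, pow_lt, H).
  assert (1 <= INR (S n)) by (rewrite S_INR; pose proof (pos_INR n); lra).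
  set (x := INR (S n)) in *.
  apply (Rmult_le_reg_r (x ^ 2 * (x + 1))); [apply Rmult_lt_0_compat; nra|].
  replace (/ x ^ 2 * (x ^ 2 * (x + 1))) with (x + 1) by (field; lra).
  replace (2 * (/ x - / (x + 1)) * (x ^ 2 * (x + 1))) with (2 * x) by (field; lra).
  lra.
- exists 2.
  assert (Hl : is_lim_seq (fun n => 2 - 2 * / INR (S (S n))) 2).
  { replace (Finite 2) with (Finite (2 - 2 * 0)) by (f_equal; ring).
    apply is_lim_seq_minus'; [apply is_lim_seq_const|].
    apply is_lim_seq_mult'; [apply is_lim_seq_const|].
    apply (is_lim_seq_inv _ p_infty); [|discriminate].
    apply -> (is_lim_seq_incr_1 (fun n => INR (S n))); apply -> (is_lim_seq_incr_1 INR); apply is_lim_seq_INR. }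
  revert Hl; apply filterlim_ext; intros n; symmetry.
  induction n as [|n IH].
  + rewrite sum_O; simpl; field.
  + rewrite sum_Sn, IH; unfold plus; simpl; ring.
Qed.

(** The quantifier order matters: one [n0] serves all sequences dominated by [b]. This yields both
    dominated convergence and the uniform convergence behind termwise integration. *)
Lemma series_tail_uniform (b : nat -> R) (eps : R) : ex_series b -> 0 < eps ->
  exists n0, forall n, (n0 <= n)%nat -> forall a, (forall j, Rabs (a j) <= b j) ->
    Rabs (Series a - sum_n a n) < eps.
Proof.
intros Hb Heps.
destruct (Series_correct _ Hb (ball (Series b) eps)) as [n0 Hn];
  [exists (mkposreal _ Heps); auto|].
exists n0; intros n Hle a Ha; specialize (Hn n Hle).
change (Rabs (sum_n b n - Series b) < eps) in Hn.
assert (Hea := ex_series_bound _ _ Ha Hb).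
apply Rle_lt_trans with (2 := Hn); rewrite (Rabs_minus_sym (sum_n b n)).
apply Rle_trans with (2 := Rle_abs _).
rewrite (Series_incr_n a (S n)), (Series_incr_n b (S n)) by (auto; lia).
simpl pred; rewrite !sum_n_Reals.
match goal with |- Rabs ?u <= ?v =>
  replace u with (Series (fun k => a (S n + k)%nat)) by ring;
  replace v with (Series (fun k => b (S n + k)%nat)) by ring end.
apply Rabs_Series_le; [intros k; apply Ha|].
apply (ex_series_incr_n b (S n)), Hb.
Qed.

(** The filter is arbitrary so that the lemma covers [K] tending to infinity as well as both
    endpoints of an improper integral moving at once. *)
Lemma tannery {T : Type} {F : (T -> Prop) -> Prop} {FF : Filter F}
  (g : T -> nat -> R) (l b : nat -> R) :
  ex_series b ->
  (forall j, Rabs (l j) <= b j) ->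
  F (fun x => forall j, Rabs (g x j) <= b j) ->
  (forall j, filterlim (fun x => g x j) F (locally (l j))) ->
  filterlim (fun x => Series (g x)) F (locally (Series l)).
Proof.
intros Hb Hl Hg Hlim; apply filterlim_locally; intros eps.
assert (Hpart : forall n, filterlim (fun x => sum_n (g x) n) F (locally (sum_n l n))).
{ induction n as [|n IH].
  - rewrite sum_O; apply filterlim_ext with (2 := Hlim 0%nat).
    intros x; rewrite sum_O; reflexivity.
  - rewrite sum_Sn; apply filterlim_ext with (fun x => plus (sum_n (g x) n) (g x (S n))).
    + intros x; rewrite sum_Sn; reflexivity.
    + apply (filterlim_comp_2 (G := locally _) (H := locally _)) with (1 := IH) (2 := Hlim (S n)).
      exact (filterlim_plus (V := R_NormedModule) (sum_n l n) (l (S n))). }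
assert (H3 : 0 < eps / 3) by (destruct eps; simpl; lra).
destruct (series_tail_uniform b _ Hb H3) as [n Hn]; specialize (Hn n (le_n n)).
assert (Hn2 := proj1 (filterlim_locally _ _) (Hpart n) (mkposreal _ H3)).
generalize (filter_and _ _ Hg Hn2); apply filter_imp; intros x [Hx1 Hx2].
change (Rabs (sum_n (g x) n - sum_n l n) < eps / 3) in Hx2.
change (Rabs (Series (g x) - Series l) < eps).
assert (A1 := Hn _ Hx1); assert (A2 := Hn _ Hl).
apply Rabs_def2 in A1; apply Rabs_def2 in A2; apply Rabs_def2 in Hx2.
apply Rabs_def1; lra.
Qed.

Lemma Series_rsum (f : nat -> R) (h : nat) :
  Series (fun j => if le_dec (S j) h then f (S j) else 0) = rsum f h.
Proof.
apply is_series_unique.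
assert (H : forall n, (h <= S n)%nat ->
  sum_n (fun j => if le_dec (S j) h then f (S j) else 0) n = rsum f h).
{ assert (H0 : forall n, sum_n (fun j => if le_dec (S j) h then f (S j) else 0) n
     = rsum f (Nat.min h (S n))).
  { induction n as [|n IH].
    - rewrite sum_O; destruct (le_dec 1 h).
      + rewrite Nat.min_r by lia; simpl; ring.
      + replace h with 0%nat by lia; reflexivity.
    - rewrite sum_Sn, IH; destruct (le_dec (S (S n)) h).
      + rewrite !Nat.min_r by lia; reflexivity.
      + rewrite !Nat.min_l by lia; apply Rplus_0_r. }
  intros n Hn; rewrite H0, Nat.min_l by lia; reflexivity. }
intros P HP; exists h; intros n Hn; rewrite H by lia; exact (locally_singleton _ _ HP).
Qed.

(** * The partial fraction expansion of [exp (x t) / (exp t - 1)] *)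

(** Infinite series start at index [0], whereas [rsum] and [csum] start at [1]; hence the [S] here
    and the [pred] in finite sums. *)
Definition ang (j : nat) : R := 2 * PI * INR (S j).

Lemma ang_ge (j : nat) : INR (S j) <= ang j.
Proof.
unfold ang; pose proof PI2_1; pose proof (lt_0_INR (S j) ltac:(lia)); nra.
Qed.

Lemma ang_ge_1 (j : nat) : 1 <= ang j.
Proof.
pose proof (ang_ge j); rewrite S_INR in H; pose proof (pos_INR j); lra.
Qed.

Definition pf_series (w : nat -> R) (t : R) : R :=
  Series (fun j => w j / (t ^ 2 + ang j ^ 2)).

Lemma pf_term_le (w : nat -> R) (t : R) (j : nat) :
  (forall j, Rabs (w j) <= 1) ->
  Rabs (w j / (t ^ 2 + ang j ^ 2)) <= / INR (S j) ^ 2.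
Proof.
intros Hw; assert (H := lt_0_INR (S j) ltac:(lia)); assert (Ha := ang_ge j).
assert (0 <= t ^ 2) by apply pow2_ge_0.
assert (INR (S j) ^ 2 <= ang j ^ 2) by (apply pow_incr; lra).
assert (0 < INR (S j) ^ 2) by (apply pow_lt; lra).
unfold Rdiv; rewrite Rabs_mult, (Rabs_pos_eq (/ _)) by (left; apply Rinv_0_lt_compat; lra).
apply Rle_trans with (1 * / (t ^ 2 + ang j ^ 2)).
- apply Rmult_le_compat_r; [left; apply Rinv_0_lt_compat; lra|apply Hw].
- rewrite Rmult_1_l; apply Rinv_le_contravar; lra.
Qed.

Lemma ex_pf_series (w : nat -> R) (t : R) :
  (forall j, Rabs (w j) <= 1) ->
  ex_series (fun j => w j / (t ^ 2 + ang j ^ 2)).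
Proof.
intros Hw; apply ex_series_bound with (2 := ex_series_inv_sq).
intros j; apply pf_term_le, Hw.
Qed.

Lemma pf_series_bound (w : nat -> R) (t : R) :
  (forall j, Rabs (w j) <= 1) ->
  Rabs (pf_series w t) <= Series (fun n => / INR (S n) ^ 2).
Proof.
intros Hw; apply Rabs_Series_le; [|exact ex_series_inv_sq].
intros j; apply pf_term_le, Hw.
Qed.

(** [u - u^3/6 >= u/3] whenever [u <= 2], and [PI / 2 <= 2]. A third is enough: it gives
    [2 N sin (PI j / N) >= 2 PI j / 3 >= j]. *)
Lemma sin_ge_third (u : R) : 0 <= u <= PI / 2 -> u / 3 <= sin u.
Proof.
intros Hu; pose proof PI_4.
apply Rle_trans with (2 := proj1 (sin_bound u 0 (proj1 Hu) ltac:(lra))).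
unfold sin_approx, sin_term; simpl.
assert (0 <= u * (4 - u * u)) by (apply Rmult_le_pos; nra).
field_simplify; nra.
Qed.

Lemma is_lim_seq_ex_derive (f : R -> R) (u : nat -> R) (x : R) :
  ex_derive f x -> is_lim_seq u x -> is_lim_seq (fun n => f (u n)) (f x).
Proof.
intros Hf Hu; apply (filterlim_comp _ _ _ u f eventually (locally x)); [exact Hu|].
exact (ex_derive_continuous f x Hf).
Qed.

Lemma exp_pow_INR (x : R) (n : nat) : exp x ^ n = exp (INR n * x).
Proof.
induction n as [|n IH]; [simpl; rewrite Rmult_0_l, exp_0; reflexivity|].
rewrite S_INR; simpl; rewrite IH, <- exp_plus; f_equal; ring.
Qed.

Lemma one_sub_exp_opp_bound (u : R) : 0 < u -> 0 < 1 - exp (- u) <= u.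
Proof.
intros Hu; split.
- assert (exp (- u) < 1); [|lra]. rewrite <- exp_0; apply exp_increasing; lra.
- assert (H := exp_ineq1_le (- u)); lra.
Qed.

(** The right-hand side depends only on [t] and [k], which makes it a majorant for Tannery's
    theorem; [exp t] compensates for [y >= exp (- t)]. The limiting terms are covered too, with
    [e = t] and [y = 1]. *)
Lemma finite_term_bound (t e tau y s c k : R) :
  0 < t -> 0 < e <= t -> exp (- t) <= y <= 1 -> 1 <= k <= tau ->
  Rabs s <= 1 -> Rabs c <= 1 ->
  Rabs (2 * (e * (s / tau) + y * c) / (e ^ 2 + y * tau ^ 2)) <=
  2 * (t + 1) * exp t * / k ^ 2.
Proof.
intros Ht He Hy Hk Hs Hc.
assert (Hpt := exp_pos (- t)); assert (Hpt' := exp_pos t).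
assert (Hk2 : 0 < k ^ 2) by (apply pow_lt; lra).
assert (Hkt : k ^ 2 <= tau ^ 2) by (apply pow_incr; lra).
assert (Hden : exp (- t) * k ^ 2 <= e ^ 2 + y * tau ^ 2).
{ assert (0 <= e ^ 2) by apply pow2_ge_0.
  assert (exp (- t) * k ^ 2 <= y * tau ^ 2) by (apply Rmult_le_compat; lra). lra. }
assert (Hd0 : 0 < exp (- t) * k ^ 2) by (apply Rmult_lt_0_compat; lra).
assert (Hnum : Rabs (e * (s / tau) + y * c) <= t + 1).
{ apply Rle_trans with (1 := Rabs_triang _ _); unfold Rdiv; rewrite !Rabs_mult.
  rewrite (Rabs_pos_eq e), (Rabs_pos_eq y), (Rabs_pos_eq (/ tau))
    by (try lra; left; apply Rinv_0_lt_compat; lra).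
  assert (/ tau <= 1) by (rewrite <- Rinv_1; apply Rinv_le_contravar; lra).
  assert (0 < / tau) by (apply Rinv_0_lt_compat; lra).
  assert (0 <= Rabs s) by apply Rabs_pos; assert (0 <= Rabs c) by apply Rabs_pos.
  assert (Rabs s * / tau <= 1 * 1) by (apply Rmult_le_compat; lra).
  assert (e * (Rabs s * / tau) <= t * 1) by (apply Rmult_le_compat; nra).
  assert (y * Rabs c <= 1 * 1) by (apply Rmult_le_compat; lra).
  lra. }
unfold Rdiv; rewrite Rabs_mult, Rabs_mult, (Rabs_pos_eq 2) by lra.
rewrite (Rabs_pos_eq (/ _)) by (left; apply Rinv_0_lt_compat; lra).
replace (2 * (t + 1) * exp t * / k ^ 2) with (2 * (t + 1) * / (exp (- t) * k ^ 2)).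
- unfold Rdiv in Hnum; apply Rmult_le_compat.
  + pose proof (Rabs_pos (e * (s * / tau) + y * c)); lra.
  + left; apply Rinv_0_lt_compat; lra.
  + lra.
  + apply Rinv_le_contravar; lra.
- rewrite exp_Ropp; field; repeat split; lra.
Qed.

(* All quantities of [finite_partial_fractions] are functions of [nu = 1 / N];
   for [N = 2 M K + 1] and [rho = 2 p K] one has [rho / N = (p / M) (1 - nu)]. *)
Lemma finite_partial_fractions_nu (M p K : nat) (t : R) :
  (0 < M)%nat -> (p <= M)%nat -> 0 < t ->
  let x := INR p / INR M in
  let nu := / INR (2 * (M * K) + 1) in
  let s j := sin ((x * (1 - nu) + nu / 2) * ang j) in
  let c j := cos (x * (1 - nu) * ang j) in
  let e := (1 - exp (- (t * nu))) / nu in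
  let y := exp (- (t * nu)) in
  let tau j := 2 * (sin (PI * INR (S j) * nu) / nu) in
  exp (- (t * (1 - x * (1 - nu)))) / (1 - exp (- t)) - y / e =
  nu * rsum (fun j => - (s (pred j) / sin (PI * INR j * nu))) (M * K) +
  e * Series (fun j => if le_dec (S j) (M * K) then
    2 * (e * (s j / tau j) + y * c j) / (e ^ 2 + y * tau j ^ 2) else 0).
Proof.
intros HM Hp Ht x nu s c e y tau.
assert (HM' := lt_0_INR _ HM).
set (N := (2 * (M * K) + 1)%nat) in *.
assert (HN : 0 < INR N) by (apply lt_0_INR; lia).
assert (HNM : INR N = 2 * INR M * INR K + 1).
{ unfold N; rewrite plus_INR, !mult_INR; simpl; ring. }
assert (Hnu : 0 < nu) by (apply Rinv_0_lt_compat, HN).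
assert (Hy : 0 < y < 1).
{ split; [apply exp_pos|].
  pose proof (one_sub_exp_opp_bound (t * nu) ltac:(apply Rmult_lt_0_compat; lra)).
  unfold y; lra. }
assert (Hrho : (2 * p * K <= 2 * (M * K))%nat) by nia.
assert (H := finite_partial_fractions (M * K) (2 * p * K) y Hy Hrho).
cbv zeta in H; fold N in H.
assert (Hrn : INR (2 * p * K) / INR N = x * (1 - nu)).
{ unfold x, nu; rewrite !mult_INR, HNM; rewrite HNM in HN; simpl; field; lra. }
assert (HyN : y ^ N = exp (- t)).
{ unfold y; rewrite exp_pow_INR; f_equal; unfold nu; field; lra. }
assert (HyNr : y ^ (N - 2 * p * K) = exp (- (t * (1 - x * (1 - nu))))).
{ unfold y; rewrite exp_pow_INR; f_equal; rewrite <- Hrn, minus_INR by lia.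
  unfold nu; field; lra. }
rewrite HyN, HyNr in H.
assert (Ht1 := one_sub_exp_opp_bound t Ht).
transitivity (nu * (INR N * exp (- (t * (1 - x * (1 - nu)))) / (1 - exp (- t))
   - y / (1 - y))).
{ unfold e, y; fold y; unfold nu; field; repeat split; try lra. }
rewrite <- H; clear H.
rewrite (Series_rsum (fun j =>
  2 * (e * (s (pred j) / tau (pred j)) + y * c (pred j)) /
    (e ^ 2 + y * tau (pred j) ^ 2))).
rewrite <- !rsum_scal, <- rsum_plus.
apply rsum_ext_loc; intros j Hj.
destruct j as [|j]; [lia|]; simpl pred; cbv zeta.
assert (HjN : (2 * S j < N)%nat) by lia; apply lt_INR in HjN.
rewrite mult_INR in HjN; simpl INR in HjN.
assert (Hj0 := lt_0_INR (S j) ltac:(lia)).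
replace ((INR (2 * p * K) + / 2) * (2 * PI * INR (S j) / INR N))
  with ((x * (1 - nu) + nu / 2) * ang j)
  by (rewrite <- Hrn; unfold ang, nu; field; lra).
replace (INR (2 * p * K) * (2 * PI * INR (S j) / INR N))
  with (x * (1 - nu) * ang j)
  by (rewrite <- Hrn; unfold ang, nu; field; lra).
replace (2 * PI * INR (S j) / INR N / 2) with (PI * INR (S j) * nu)
  by (unfold nu; field; lra).
fold (s j) (c j).
unfold e, tau; fold y.
set (sg := sin (PI * INR (S j) * nu)).
assert (Hsg : 0 < sg).
{ pose proof PI_RGT_0; apply sin_gt_0.
  - apply Rmult_lt_0_compat; [nra|lra].
  - apply Rmult_lt_reg_r with (INR N); [lra|].
    unfold nu; rewrite Rmult_assoc, Rinv_l, Rmult_1_r by lra.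
    change (INR (S j)) with (match j with O => 1 | S _ => INR j + 1 end) in *.
    apply Rmult_lt_compat_l; [lra|]. destruct j; lra. }
assert (HE : 0 < (1 - y) ^ 2 + 4 * y * sg ^ 2).
{ assert (0 < (1 - y) ^ 2) by (apply pow_lt; lra).
  assert (0 <= sg ^ 2) by apply pow2_ge_0; nra. }
field; repeat split; try lra.
Qed.

Lemma is_lim_seq_linear_0 (a : R) (u : nat -> R) :
  is_lim_seq u 0 -> is_lim_seq (fun n => a * u n) 0.
Proof.
intros Hu; replace (Finite 0) with (Finite (a * 0)) by (f_equal; ring).
apply is_lim_seq_mult'; [apply is_lim_seq_const|exact Hu].
Qed.

Lemma is_lim_seq_expm1 (t : R) (nu : nat -> R) :
  0 < t -> (forall n, 0 < nu n) -> is_lim_seq nu 0 ->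
  is_lim_seq (fun n => (1 - exp (- (t * nu n))) / nu n) t.
Proof.
intros Ht Hpos Hnu.
apply is_lim_seq_ext with
  (fun n => t * ((exp (- t * nu n) - 1) / (- t * nu n))).
- intros n; specialize (Hpos n).
  replace (- (t * nu n)) with (- t * nu n) by ring; field; lra.
- replace (Finite t) with (Finite (t * 1)) by (f_equal; ring).
  apply is_lim_seq_mult'; [apply is_lim_seq_const|].
  apply (is_lim_comp_seq (fun y => (exp y - 1) / y) _ 0 1 is_lim_div_expm1_0).
  + exists 0%nat; intros n _ H; injection H; specialize (Hpos n); nra.
  + apply is_lim_seq_linear_0, Hnu.
Qed.

Lemma is_lim_seq_sinc (a : R) (nu : nat -> R) :
  0 < a -> (forall n, 0 < nu n) -> is_lim_seq nu 0 ->
  is_lim_seq (fun n => sin (a * nu n) / nu n) a.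
Proof.
intros Ha Hpos Hnu.
apply is_lim_seq_ext with (fun n => a * (sin (a * nu n) / (a * nu n))).
- intros n; specialize (Hpos n); field; lra.
- replace (Finite a) with (Finite (a * 1)) by (f_equal; ring).
  apply is_lim_seq_mult'; [apply is_lim_seq_const|].
  apply (is_lim_comp_seq (fun y => sin y / y) _ 0 1 is_lim_sinc_0).
  + exists 0%nat; intros n _ H; injection H; specialize (Hpos n); nra.
  + apply is_lim_seq_linear_0, Hnu.
Qed.

Lemma is_lim_seq_inv_odd (M : nat) : (0 < M)%nat ->
  is_lim_seq (fun K => / INR (2 * (M * K) + 1)) 0.
Proof.
intros HM.
apply (is_lim_seq_inv _ p_infty); [|discriminate].
apply is_lim_seq_le_p_loc with (2 := is_lim_seq_INR).
exists 0%nat; intros n _; apply le_INR; nia.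
Qed.

Lemma pf_weight_sin_le (u : R) (j : nat) : Rabs (sin u / ang j) <= 1.
Proof.
unfold Rdiv; rewrite Rabs_mult, (Rabs_pos_eq (/ _))
  by (left; apply Rinv_0_lt_compat; pose proof (ang_ge_1 j); lra).
assert (Rabs (sin u) <= 1) by (apply Rabs_le, SIN_bound).
assert (0 < / ang j <= 1).
{ pose proof (ang_ge_1 j); split; [apply Rinv_0_lt_compat; lra|].
  rewrite <- Rinv_1; apply Rinv_le_contravar; lra. }
pose proof (Rabs_pos (sin u)); nra.
Qed.

Lemma cos_le_1 (u : R) : Rabs (cos u) <= 1.
Proof. apply Rabs_le, COS_bound. Qed.

Lemma sin_le_1 (u : R) : Rabs (sin u) <= 1.
Proof. apply Rabs_le, SIN_bound. Qed.

(** [t * pf_total x t] is the sum, over the pairs of poles [i ang j] and [- i ang j], of the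
    principal parts of [exp (x t) / (exp t - 1)], each pair less its value
    [- 2 sin (x ang j) / ang j] at [t = 0]. The subtraction makes the terms of order [1 / j^2]. *)
Definition pf_total (x t : R) : R :=
  2 * (pf_series (fun j => cos (x * ang j)) t +
       t * pf_series (fun j => sin (x * ang j) / ang j) t).

(* Tannery's theorem for [finite_partial_fractions_nu] as [K] tends to infinity. *)
Lemma partial_fractions (M p : nat) :
  (0 < M)%nat -> (p <= M)%nat ->
  let x := INR p / INR M in
  exists c : R, forall t : R, 0 < t ->
    exp (x * t) / (exp t - 1) - / t - c = t * pf_total x t.
Proof.
intros HM Hp x.
set (nu := fun K => / INR (2 * (M * K) + 1)).
assert (Hnu0 : is_lim_seq nu 0) by (apply is_lim_seq_inv_odd, HM).
assert (Hnup : forall K, 0 < nu K) by (intros K; apply Rinv_0_lt_compat, lt_0_INR; lia).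
assert (Hnu1 : forall K, nu K <= 1).
{ intros K; unfold nu; rewrite <- Rinv_1; apply Rinv_le_contravar; [lra|].
  rewrite <- INR_1; apply le_INR; lia. }
(* [cc] collects the values subtracted from the finite principal parts and does not involve [t]. Its
   limit, computed below for each [t], is therefore the same for all of them. *)
set (cc := fun K => nu K * rsum (fun j =>
  - (sin ((x * (1 - nu K) + nu K / 2) * ang (pred j)) /
     sin (PI * INR j * nu K))) (M * K)).
assert (Hcc : forall t, 0 < t ->
  is_lim_seq cc (exp (x * t) / (exp t - 1) - / t - t * pf_total x t)).
{ intros t Ht.
  set (e := fun K => (1 - exp (- (t * nu K))) / nu K).
  set (y := fun K => exp (- (t * nu K))).
  set (s := fun K j => sin ((x * (1 - nu K) + nu K / 2) * ang j)).
  set (c := fun K j => cos (x * (1 - nu K) * ang j)).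
  set (tau := fun K j => 2 * (sin (PI * INR (S j) * nu K) / nu K)).
  set (g := fun K j => if le_dec (S j) (M * K) then
    2 * (e K * (s K j / tau K j) + y K * c K j) /
      (e K ^ 2 + y K * tau K j ^ 2) else 0).
  assert (He : is_lim_seq e t) by (apply is_lim_seq_expm1; assumption).
  assert (Hy : is_lim_seq y 1).
  { replace 1 with (exp (- (t * 0))) by (rewrite Rmult_0_r, Ropp_0; apply exp_0).
    apply (is_lim_seq_ex_derive (fun v => exp (- (t * v)))); [|exact Hnu0].
    auto_derive; exact I. }
  assert (Hg : is_lim_seq (fun K => Series (g K)) (pf_total x t)).
  { set (l := fun j => 2 * (cos (x * ang j) / (t ^ 2 + ang j ^ 2) +
       t * (sin (x * ang j) / ang j / (t ^ 2 + ang j ^ 2)))).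
    replace (pf_total x t) with (Series l).
    2: { unfold l, pf_total, pf_series.
         rewrite Series_scal_l, Series_plus, Series_scal_l; [reflexivity| |].
         - apply (ex_pf_series (fun j => cos (x * ang j))); intros; apply cos_le_1.
         - apply (ex_series_scal (K := R_AbsRing) (V := R_NormedModule)).
           apply (ex_pf_series (fun j => sin (x * ang j) / ang j)).
           intros; apply pf_weight_sin_le. }
    apply (tannery g l (fun j => 2 * (t + 1) * exp t * / INR (S j) ^ 2)).
    - apply (ex_series_scal (K := R_AbsRing) (V := R_NormedModule)), ex_series_inv_sq.
    - intros j; unfold l.
      replace (2 * (cos (x * ang j) / (t ^ 2 + ang j ^ 2) +
         t * (sin (x * ang j) / ang j / (t ^ 2 + ang j ^ 2))))
      with (2 * (t * (sin (x * ang j) / ang j) + 1 * cos (x * ang j)) /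
        (t ^ 2 + 1 * ang j ^ 2)).
      + pose proof (one_sub_exp_opp_bound t Ht).
        apply finite_term_bound; [lra|lra|lra| |apply sin_le_1|apply cos_le_1].
        split; [rewrite S_INR; pose proof (pos_INR j); lra|apply ang_ge].
      + pose proof (ang_ge_1 j); assert (0 < t ^ 2 + ang j ^ 2) by nra.
        field; split; nra.
    - exists 0%nat; intros K _ j; unfold g.
      assert (0 < INR (S j)) by (apply lt_0_INR; lia).
      destruct (le_dec (S j) (M * K)) as [HjK|HjK].
      + specialize (Hnup K); specialize (Hnu1 K).
        assert (Htn : 0 < t * nu K) by (apply Rmult_lt_0_compat; lra).
        assert (H1 := one_sub_exp_opp_bound _ Htn).
        apply finite_term_bound; [exact Ht| | | |apply sin_le_1|apply cos_le_1].
        * unfold e; split; [apply Rdiv_lt_0_compat; lra|].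
          apply (Rmult_le_reg_r (nu K)); [lra|]; unfold Rdiv.
          rewrite Rmult_assoc, Rinv_l by lra; lra.
        * unfold y; split; [|lra].
          destruct (Rle_lt_or_eq_dec _ _ Hnu1) as [Hn|Hn].
          -- left; apply exp_increasing; nra.
          -- rewrite Hn, Rmult_1_r; lra.
        * split; [rewrite S_INR; pose proof (pos_INR j); lra|].
          unfold tau.
          (* Only indices below [N / 2] occur, so the angle [PI j / N] stays in the range of
             [sin_ge_third]. *)
          assert (HjN : 2 * INR (S j) * nu K <= 1).
          { unfold nu; apply (Rmult_le_reg_r (INR (2 * (M * K) + 1))).
            - apply lt_0_INR; lia.
            - rewrite Rmult_assoc, Rinv_l, Rmult_1_r, Rmult_1_l
                by (apply not_0_INR; lia).
              change 2 with (INR 2); rewrite <- mult_INR; apply le_INR; lia. }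
          pose proof PI2_3_2.
          assert (0 < INR (S j) * nu K) by (apply Rmult_lt_0_compat; lra).
          assert (Hs : PI * INR (S j) * nu K / 3 <= sin (PI * INR (S j) * nu K))
            by (apply sin_ge_third; rewrite Rmult_assoc; split; nra).
          apply (Rmult_le_reg_r (nu K)); [lra|].
          replace (2 * (sin (PI * INR (S j) * nu K) / nu K) * nu K)
            with (2 * sin (PI * INR (S j) * nu K)) by (field; lra).
          nra.
      + rewrite Rabs_R0; left; pose proof (exp_pos t).
        apply Rmult_lt_0_compat; [nra|]; apply Rinv_0_lt_compat, pow_lt; lra.
    - intros j; change (is_lim_seq (fun K => g K j) (l j)).
      apply is_lim_seq_ext_loc with (fun K =>
        2 * (e K * (s K j / tau K j) + y K * c K j) / (e K ^ 2 + y K * tau K j ^ 2)).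
      { exists (S j); intros K HK; unfold g.
        destruct (le_dec (S j) (M * K)); [reflexivity|nia]. }
      assert (Hs : is_lim_seq (fun K => s K j) (sin (x * ang j))).
      { replace (x * ang j) with ((x * (1 - 0) + 0 / 2) * ang j) by field.
        apply (is_lim_seq_ex_derive (fun v => sin ((x * (1 - v) + v / 2) * ang j)));
          [|exact Hnu0].
        auto_derive; exact I. }
      assert (Hc : is_lim_seq (fun K => c K j) (cos (x * ang j))).
      { replace (x * ang j) with (x * (1 - 0) * ang j) by ring.
        apply (is_lim_seq_ex_derive (fun v => cos (x * (1 - v) * ang j)));
          [|exact Hnu0].
        auto_derive; exact I. }
      assert (Htau : is_lim_seq (fun K => tau K j) (ang j)).
      { replace (ang j) with (2 * (PI * INR (S j))) by (unfold ang; ring).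
        apply is_lim_seq_mult'; [apply is_lim_seq_const|].
        apply is_lim_seq_sinc; try assumption.
        apply Rmult_lt_0_compat; [apply PI_RGT_0|apply lt_0_INR; lia]. }
      pose proof (ang_ge_1 j).
      unfold l.
      replace (2 * (cos (x * ang j) / (t ^ 2 + ang j ^ 2) +
         t * (sin (x * ang j) / ang j / (t ^ 2 + ang j ^ 2))))
      with (2 * (t * (sin (x * ang j) / ang j) + 1 * cos (x * ang j)) /
        (t * t + 1 * (ang j * ang j))) by (field; split; nra).
      apply is_lim_seq_ext with (fun K =>
        2 * (e K * (s K j / tau K j) + y K * c K j) /
          (e K * e K + y K * (tau K j * tau K j))).
      { intros K; f_equal; f_equal; ring. }
      apply is_lim_seq_div'; [| |nra].
      + apply is_lim_seq_mult'; [apply is_lim_seq_const|].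
        apply is_lim_seq_plus'; apply is_lim_seq_mult'; try assumption.
        apply is_lim_seq_div'; try assumption; lra.
      + apply is_lim_seq_plus'; apply is_lim_seq_mult'; try assumption.
        apply is_lim_seq_mult'; assumption. }
  apply is_lim_seq_ext with (fun K =>
    exp (- (t * (1 - x * (1 - nu K)))) / (1 - exp (- t)) - y K / e K -
    e K * Series (g K)).
  { intros K; unfold cc.
    assert (E := finite_partial_fractions_nu M p K t HM Hp Ht); cbv zeta in E.
    unfold g, s, c, tau, e, y, nu, x; rewrite E; ring. }
  pose proof (one_sub_exp_opp_bound t Ht).
  replace (exp (x * t) / (exp t - 1) - / t) with
    (exp (- (t * (1 - x * (1 - 0)))) / (1 - exp (- t)) - 1 / t).
  - apply is_lim_seq_minus'; [apply is_lim_seq_minus'|].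
    + apply is_lim_seq_div'; [|apply is_lim_seq_const|lra].
      apply (is_lim_seq_ex_derive (fun v => exp (- (t * (1 - x * (1 - v))))));
        [auto_derive; exact I|exact Hnu0].
    + apply is_lim_seq_div'; try assumption; lra.
    + apply is_lim_seq_mult'; assumption.
  - replace (- (t * (1 - x * (1 - 0)))) with (x * t + - t) by ring.
    rewrite exp_plus, exp_Ropp.
    assert (1 < exp t) by (rewrite <- exp_0; apply exp_increasing, Ht).
    field; repeat split; try lra. }
(* The limit of [cc], read off at [t = 1]. *)
exists (exp (x * 1) / (exp 1 - 1) - / 1 - 1 * pf_total x 1).
intros t Ht.
assert (H1 := is_lim_seq_unique _ _ (Hcc 1 Rlt_0_1)).
assert (H2 := is_lim_seq_unique _ _ (Hcc t Ht)).
rewrite H1 in H2; injection H2; intros H; rewrite H; ring.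
Qed.

(** * Generated fields *)

Lemma sfg_zero S : subfield_gen S 0%C.
Proof.
rewrite <- (Cplus_opp_r 1).
apply sfg_add; [|apply sfg_opp]; apply sfg_one.
Qed.

Lemma sfg_Rplus S (a b : R) :
  subfield_gen S a -> subfield_gen S b -> subfield_gen S (a + b)%R.
Proof. rewrite RtoC_plus; apply sfg_add. Qed.

Lemma sfg_Ropp S (a : R) : subfield_gen S a -> subfield_gen S (- a)%R.
Proof. rewrite RtoC_opp; apply sfg_opp. Qed.

Lemma sfg_Rmult S (a b : R) :
  subfield_gen S a -> subfield_gen S b -> subfield_gen S (a * b)%R.
Proof. rewrite RtoC_mult; apply sfg_mul. Qed.

(* The inversion clause of [subfield_gen] elaborates with a real [z]. *)
Lemma sfg_Rinv S (a : R) : a <> 0 -> subfield_gen S a -> subfield_gen S (/ a)%R.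
Proof.
intros Ha H; rewrite RtoC_inv by exact Ha; exact (sfg_inv _ _ Ha H).
Qed.

Lemma sfg_INR S n : subfield_gen S (INR n).
Proof.
induction n as [|n IH]; [apply sfg_zero|].
rewrite S_INR; apply sfg_Rplus; [exact IH|apply sfg_one].
Qed.

Lemma sfg_pow S z n : subfield_gen S z -> subfield_gen S (z ^ n)%C.
Proof.
intros Hz; induction n as [|n IH]; [apply sfg_one|apply sfg_mul; assumption].
Qed.

Lemma sfg_Rpow S (x : R) n : subfield_gen S x -> subfield_gen S (x ^ n)%R.
Proof.
intros Hx; induction n as [|n IH]; [apply sfg_one|apply sfg_Rmult; assumption].
Qed.

(** Every punctured neighbourhood of [t] contains some positive [t + eps / 2], so inversion in the
    field of functions can be justified from values on the positive axis alone. *)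
Lemma mero_eq_zero_false (f : C -> C) (t : R) :
  0 < t -> (forall u : R, 0 < u -> f u <> 0%C) -> ~ mero_eq f (fun _ => 0%C).
Proof.
intros Ht Hf H; destruct (H t) as [eps Heps].
apply (Hf (t + eps / 2)); [destruct eps; simpl; lra|].
apply Heps.
- destruct eps as [eps He]; split; unfold ball; simpl;
    unfold AbsRing_ball, abs, minus, plus, opp; simpl.
  + replace (t + eps / 2 + - t) with (eps / 2) by ring.
    rewrite Rabs_pos_eq; lra.
  + rewrite Ropp_0, Rplus_0_r, Rabs_R0; exact He.
- intros E; apply RtoC_inj in E; destruct eps; simpl in *; lra.
Qed.

Lemma mfg_pow (K : C -> Prop) f n : K 1%C -> mero_field_gen K f ->
  mero_field_gen K (fun t => (f t ^ n)%C).
Proof.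
intros K1 Hf; induction n as [|n IH]; [exact (mfg_const _ _ K1)|].
exact (mfg_mul _ _ _ Hf IH).
Qed.

Lemma Cexp_RtoC (x : R) : Cexp x = RtoC (exp x).
Proof. unfold Cexp; simpl; rewrite cos_0, sin_0; unfold RtoC; f_equal; ring. Qed.

Lemma mero_field_exp S (p : nat) : exists F,
  mero_field_gen (subfield_gen S) F /\
  forall t : R, F t = RtoC (exp (INR p * t)).
Proof.
exists (fun t => (/ Cexp (- t)) ^ p)%C; split.
- apply mfg_pow; [apply sfg_one|]; apply mfg_inv; [|apply mfg_exp].
  apply (mero_eq_zero_false _ 1); [lra|]; intros u _.
  rewrite <- RtoC_opp, Cexp_RtoC; intros E; apply RtoC_inj in E.
  pose proof (exp_pos (- u)); lra.
- intros t; rewrite <- RtoC_opp, Cexp_RtoC.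
  rewrite <- RtoC_inv, <- RtoC_pow by apply Rgt_not_eq, exp_pos.
  rewrite <- exp_Ropp, Ropp_involutive, exp_pow_INR; reflexivity.
Qed.

(** * Functions with a power series at [0] over the field of constants *)

(* The second half records that [D] belongs to the field after the rescaling
   [t -> M t], which makes [exp (p t / M)] a power of [exp t]. *)
Definition tame (S : C -> Prop) (M : nat) (D : R -> R) : Prop :=
  (exists g : nat -> R, (forall k, subfield_gen S (g k)) /\
    forall t, 0 < t -> is_pseries g t (D t)) /\
  (exists F, mero_field_gen (subfield_gen S) F /\
    forall t : R, 0 < t -> F t = RtoC (D (INR M * t))).

Lemma tame_ext S M D E : (0 < M)%nat ->
  (forall t, 0 < t -> D t = E t) -> tame S M D -> tame S M E.
Proof.
intros HM H [[g [Hg HD]] [F [HF HFD]]]; split.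
- exists g; split; [exact Hg|]; intros t Ht; rewrite <- H by exact Ht; auto.
- exists F; split; [exact HF|]; intros t Ht; rewrite <- H; auto.
  apply Rmult_lt_0_compat; [apply lt_0_INR, HM|exact Ht].
Qed.

Lemma tame_plus S M D E : tame S M D -> tame S M E ->
  tame S M (fun t => D t + E t).
Proof.
intros [[g [Hg HD]] [F [HF HFD]]] [[h [Hh HE]] [G [HG HGE]]]; split.
- exists (PS_plus g h); split; [intros k; apply sfg_Rplus; auto|].
  intros t Ht; exact (is_pseries_plus (V := R_NormedModule) g h t _ _ (HD t Ht) (HE t Ht)).
- exists (fun t => F t + G t)%C; split; [apply mfg_add; assumption|].
  intros t Ht; rewrite HFD, HGE, RtoC_plus by exact Ht; reflexivity.
Qed.

Lemma tame_scal S M c D : subfield_gen S (RtoC c) -> tame S M D ->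
  tame S M (fun t => c * D t).
Proof.
intros Hc [[g [Hg HD]] [F [HF HFD]]]; split.
- exists (PS_scal c g); split; [intros k; apply sfg_Rmult; auto|].
  intros t Ht.
  exact (is_pseries_scal (V := R_NormedModule) c g t _ (Rmult_comm _ _) (HD t Ht)).
- exists (fun t => RtoC c * F t)%C; split; [apply mfg_mul; [apply mfg_const|]; assumption|].
  intros t Ht; rewrite HFD, RtoC_mult by exact Ht; reflexivity.
Qed.

Lemma tame_exp S M p : (0 < M)%nat -> tame S M (fun t => exp (INR p / INR M * t)).
Proof.
intros HM; assert (HM' := lt_0_INR _ HM); split.
- set (x := INR p / INR M).
  assert (Hx : subfield_gen S x).
  { apply sfg_Rmult; [|apply sfg_Rinv; [lra|]]; apply sfg_INR. }
  exists (fun k => x ^ k * / INR (fact k)); split.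
  + intros k; apply sfg_Rmult; [apply sfg_Rpow, Hx|].
    apply sfg_Rinv; [apply INR_fact_neq_0|apply sfg_INR].
  + intros t _; assert (H := is_exp_Reals (x * t)); revert H.
    apply is_series_ext; intros k; unfold scal; simpl; unfold mult; simpl.
    rewrite (pow_n_pow t), (pow_n_pow (x * t)), Rpow_mult_distr; ring.
- destruct (mero_field_exp S p) as [F [HF HFe]]; exists F; split; [exact HF|].
  intros t _; rewrite HFe; f_equal; f_equal; field; lra.
Qed.

Lemma is_pseries_limit_0 (g : nat -> R) (D : R -> R) :
  (forall t, 0 < t -> is_pseries g t (D t)) ->
  filterlim D (at_right 0) (locally (g 0%nat)).
Proof.
intros HD.
assert (Hr : Rbar_lt 0 (CV_radius g)).
(* Convergence at [t = 1] excludes radius [0], since the general term tends to [0] there. *)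
{ destruct (Rbar_lt_le_dec 0 (CV_radius g)) as [H|H]; [exact H|exfalso].
  apply (CV_disk_outside g 1).
  - apply Rbar_le_lt_trans with (1 := H); simpl; rewrite Rabs_R1; lra.
  - assert (H1 : ex_series (fun n => scal (pow_n 1 n) (g n)))
      by (eexists; apply HD; lra).
    apply ex_series_lim_0 in H1; revert H1; apply is_lim_seq_ext.
    intros n; rewrite pow_n_pow; apply Rmult_comm. }
assert (Hc : continuous (PSeries g) 0).
{ apply continuity_pt_filterlim, PSeries_continuity; rewrite Rabs_R0; exact Hr. }
rewrite <- (PSeries_0 g).
apply filterlim_ext_loc with (PSeries g).
- exists (mkposreal 1 Rlt_0_1); intros t _ Ht; apply is_pseries_unique, HD, Ht.
- intros P HP; destruct (Hc P HP) as [eps Heps]; exists eps; auto.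
Qed.

Lemma filterlim_at_right_unique (D : R -> R) (a b : R) :
  filterlim D (at_right 0) (locally a) ->
  filterlim D (at_right 0) (locally b) -> a = b.
Proof.
exact (filterlim_locally_unique (F := at_right 0) (V := R_NormedModule) D a b).
Qed.

(** The limit [a] must be the coefficient [g 0], hence a constant of the field however it was
    obtained; removing it and dividing by [t] shifts the power series by one. The factor [/ INR M]
    in the witness undoes the rescaling of [t]. *)
Lemma tame_div S M D (a : R) : (0 < M)%nat -> tame S M D ->
  filterlim D (at_right 0) (locally a) ->
  subfield_gen S (RtoC a) /\ tame S M (fun t => (D t - a) / t).
Proof.
intros HM [[g [Hg HD]] [F [HF HFD]]] Ha.
assert (HM' := lt_0_INR _ HM).
assert (Ea : a = g 0%nat)
  by (apply (filterlim_at_right_unique D); [exact Ha|apply is_pseries_limit_0, HD]).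
assert (Ka : subfield_gen S a) by (rewrite Ea; apply Hg).
split; [exact Ka|split].
- exists (PS_decr_1 g); split; [intros k; apply Hg|].
  intros t Ht.
  replace ((D t - a) / t) with (/ t * (D t + - g 0%nat)) by (rewrite Ea; field; lra).
  exact (is_pseries_decr_1 (V := R_NormedModule) g t (/ t) (D t)
    (Rinv_l t (Rgt_not_eq _ _ Ht)) (HD t Ht)).
- exists (fun t => (F t + - RtoC a) * (RtoC (/ INR M) * / t))%C; split.
  + apply mfg_mul; [apply mfg_add; [exact HF|apply mfg_opp, mfg_const, Ka]|].
    apply mfg_mul; [apply mfg_const, sfg_Rinv; [lra|apply sfg_INR]|].
    apply mfg_inv; [|apply mfg_var].
    apply (mero_eq_zero_false _ 1); [lra|].
    intros u Hu E; apply RtoC_inj in E; lra.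
  + intros t Ht; rewrite HFD by exact Ht.
    rewrite <- RtoC_opp, <- RtoC_plus, <- RtoC_inv, <- !RtoC_mult by lra.
    f_equal; field; lra.
Qed.

Lemma filterlim_Rplus {T : Type} (F : (T -> Prop) -> Prop) {FF : Filter F}
  (f g : T -> R) (a b : R) :
  filterlim f F (locally a) -> filterlim g F (locally b) ->
  filterlim (fun t => f t + g t) F (locally (a + b)).
Proof.
intros Hf Hg; apply (filterlim_comp_2 (G := locally a) (H := locally b)) with (1 := Hf) (2 := Hg).
exact (filterlim_plus (V := R_NormedModule) a b).
Qed.

Lemma filterlim_Rmult {T : Type} (F : (T -> Prop) -> Prop) {FF : Filter F}
  (f g : T -> R) (a b : R) :
  filterlim f F (locally a) -> filterlim g F (locally b) ->
  filterlim (fun t => f t * g t) F (locally (a * b)).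
Proof.
intros Hf Hg; apply (filterlim_comp_2 (G := locally a) (H := locally b)) with (1 := Hf) (2 := Hg).
exact (filterlim_mult (K := R_AbsRing) a b).
Qed.

Lemma filterlim_at_right_bounded (f : R -> R) (b : R) :
  (forall t, 0 < t -> Rabs (f t) <= b) ->
  filterlim (fun t => t * f t) (at_right 0) (locally 0).
Proof.
intros Hf; apply filterlim_locally; intros eps.
assert (Hb : 0 < Rabs b + 1) by (pose proof (Rabs_pos b); lra).
assert (Hd : 0 < eps / (Rabs b + 1)) by (apply Rdiv_lt_0_compat; [apply cond_pos|exact Hb]).
exists (mkposreal _ Hd); intros t Ht Ht0.
change (Rabs (t - 0) < eps / (Rabs b + 1)) in Ht.
change (Rabs (t * f t - 0) < eps).
rewrite Rminus_0_r, Rabs_pos_eq in Ht by lra.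
rewrite Rminus_0_r, Rabs_mult, (Rabs_pos_eq t) by lra.
apply Rle_lt_trans with (t * (Rabs b + 1)).
- apply Rmult_le_compat_l; [lra|].
  specialize (Hf t Ht0); pose proof (Rle_abs b); lra.
- apply (Rmult_lt_reg_r (/ (Rabs b + 1))); [apply Rinv_0_lt_compat, Hb|].
  rewrite Rmult_assoc, Rinv_r, Rmult_1_r by lra; exact Ht.
Qed.

Lemma filterlim_at_right_ext (f g : R -> R) (l : R) :
  (forall t, 0 < t -> f t = g t) ->
  filterlim f (at_right 0) (locally l) -> filterlim g (at_right 0) (locally l).
Proof.
intros H; apply filterlim_ext_loc.
exists (mkposreal 1 Rlt_0_1); intros t _ Ht; auto.
Qed.

Lemma filterlim_at_right_ex_derive (f : R -> R) :
  ex_derive f 0 -> filterlim f (at_right 0) (locally (f 0)).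
Proof.
intros Hf P HP; destruct (ex_derive_continuous f 0 Hf P HP) as [eps Heps].
exists eps; auto.
Qed.

Definition expm1_div (t : R) : R := (exp t - 1) / t.

Lemma expm1_div_limit : filterlim expm1_div (at_right 0) (locally 1).
Proof.
assert (H := is_lim_div_expm1_0).
intros P HP; destruct (H P HP) as [eps Heps]; exists eps.
intros t Ht Ht0; apply Heps; [exact Ht|lra].
Qed.

Lemma tame_expm1_div S M : (0 < M)%nat -> tame S M expm1_div.
Proof.
intros HM; assert (HM' := lt_0_INR _ HM).
assert (H := tame_exp S M M HM).
apply (tame_ext _ _ _ exp HM) in H;
  [|intros t _; f_equal; field; lra].
apply (tame_div S M exp 1 HM H).
rewrite <- exp_0; apply filterlim_at_right_ex_derive; auto_derive; exact I.
Qed.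

Lemma tame_opp S M D : tame S M D -> tame S M (fun t => -1 * D t).
Proof. apply tame_scal, sfg_Ropp, sfg_one. Qed.

Lemma tame_expm1_div2 S M : (0 < M)%nat ->
  tame S M (fun t => (expm1_div t - 1) / t).
Proof.
intros HM; apply (tame_div S M expm1_div 1 HM (tame_expm1_div S M HM)), expm1_div_limit.
Qed.

Lemma tame_div_t S M D E : (0 < M)%nat -> tame S M D ->
  (forall t, 0 < t -> D t = t * E t) ->
  filterlim D (at_right 0) (locally 0) -> tame S M E.
Proof.
intros HM HD HE Hl; apply tame_ext with (3 := proj2 (tame_div S M D 0 HM HD Hl)); [exact HM|].
intros t Ht; rewrite HE by exact Ht; field; lra.
Qed.

(** * Tameness of the partial fraction series *)

Definition series_inv_sq : R := Series (fun n => / INR (S n) ^ 2).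

Lemma div_ang_sq_le (w : nat -> R) :
  (forall j, Rabs (w j) <= 1) -> forall j, Rabs (w j / ang j ^ 2) <= 1.
Proof.
intros Hw j; unfold Rdiv; rewrite Rabs_mult.
pose proof (ang_ge_1 j); pose proof (Hw j); pose proof (Rabs_pos (w j)).
assert (1 <= ang j ^ 2) by nra.
assert (/ ang j ^ 2 <= 1) by (rewrite <- Rinv_1; apply Rinv_le_contravar; lra).
assert (0 < / ang j ^ 2) by (apply Rinv_0_lt_compat; lra).
rewrite (Rabs_pos_eq (/ _)) by lra; nra.
Qed.

Lemma pf_series_shift (w : nat -> R) (t : R) :
  (forall j, Rabs (w j) <= 1) ->
  pf_series w t =
  Series (fun j => w j / ang j ^ 2) - t * (t * pf_series (fun j => w j / ang j ^ 2) t).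
Proof.
intros Hw; unfold pf_series.
rewrite <- !Series_scal_l, <- Series_minus.
- apply Series_ext; intros j; pose proof (ang_ge_1 j).
  field; split; nra.
- apply ex_series_ext with (2 := ex_pf_series w 0 Hw).
  intros j; f_equal; ring.
- apply (ex_series_scal (K := R_AbsRing) (V := R_NormedModule) t).
  apply (ex_series_scal (K := R_AbsRing) (V := R_NormedModule) t).
  apply ex_pf_series, div_ang_sq_le, Hw.
Qed.

Lemma pf_series_mul_t_limit (w : nat -> R) :
  (forall j, Rabs (w j) <= 1) ->
  filterlim (fun t => t * pf_series w t) (at_right 0) (locally 0).
Proof.
intros Hw; apply (filterlim_at_right_bounded _ series_inv_sq).
intros t _; apply pf_series_bound, Hw.
Qed.

Lemma at_right_id : filterlim (fun t : R => t) (at_right 0) (locally 0).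
Proof. apply (filterlim_at_right_ex_derive (fun t => t)); auto_derive; exact I. Qed.

(** [pf_series w] alone has poles at [i ang j] and [- i ang j], so in general no power series
    represents it for all [t > 0]. The zeros of [expm1_div] cancel these poles, and its value [1] at
    [0] keeps limits there unchanged. *)
Definition tame_pf (S : C -> Prop) (M : nat) (w : nat -> R) : Prop :=
  tame S M (fun t => expm1_div t * pf_series w t).

(** By [1 / (t^2 + a^2) = 1 / a^2 - t^2 / (a^2 (t^2 + a^2))], dividing the weights by [a^2] amounts
    to removing the value at [0] and dividing by [t] twice, up to sign. *)
Lemma tame_pf_div_sq S M (w : nat -> R) : (0 < M)%nat ->
  (forall j, Rabs (w j) <= 1) ->
  tame_pf S M w -> tame_pf S M (fun j => w j / ang j ^ 2).
Proof.
intros HM Hw Hp; assert (Hw' := div_ang_sq_le w Hw).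
set (w' := fun j => w j / ang j ^ 2) in *.
set (s := Series (fun j => w j / ang j ^ 2)).
assert (Hsh : forall t, pf_series w t = s - t * (t * pf_series w' t))
  by (intros t; apply pf_series_shift, Hw).
assert (Hl := pf_series_mul_t_limit w' Hw').
assert (Hlim : filterlim (fun t => expm1_div t * pf_series w t) (at_right 0) (locally s)).
{ replace s with (1 * (s + -1 * (0 * 0))) by ring.
  apply filterlim_Rmult; [apply at_right_proper_filter|apply expm1_div_limit|].
  apply filterlim_at_right_ext with (fun t => s + -1 * (t * (t * pf_series w' t)));
    [intros t _; rewrite Hsh; ring|].
  repeat first [apply filterlim_Rplus|apply filterlim_Rmult|apply filterlim_const
    |apply Hl|apply at_right_id|apply at_right_proper_filter]. }
destruct (tame_div _ _ _ _ HM Hp Hlim) as [Ks Hd].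
(* The constant [s] comes multiplied by [expm1_div t], so subtracting [s] alone leaves
   [s * (expm1_div t - 1) / t], which is tame and is removed here. *)
assert (H := tame_plus _ _ _ _ Hd (tame_opp _ _ _
  (tame_scal _ _ _ _ Ks (tame_expm1_div2 S M HM)))).
assert (H' : tame S M (fun t => t * (-1 * (expm1_div t * pf_series w' t)))).
{ apply tame_ext with (3 := H); [exact HM|].
  intros t Ht; rewrite Hsh; field; lra. }
apply tame_ext with (fun t => -1 * (-1 * (expm1_div t * pf_series w' t)));
  [exact HM|intros; ring|apply tame_opp].
apply tame_div_t with (2 := H'); [exact HM|reflexivity|].
apply filterlim_at_right_ext with (fun t => -1 * (expm1_div t * (t * pf_series w' t)));
  [intros; ring|].
replace (locally 0) with (locally (-1 * (1 * 0))) by (f_equal; ring).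
repeat first [apply filterlim_Rmult|apply filterlim_const
    |apply Hl|apply expm1_div_limit|apply at_right_proper_filter].
Qed.

Lemma pf_total_mul_t_limit (x : R) :
  filterlim (fun t => t * pf_total x t) (at_right 0) (locally 0).
Proof.
unfold pf_total.
apply filterlim_at_right_ext with (fun t =>
  2 * (t * pf_series (fun j => cos (x * ang j)) t +
       t * (t * pf_series (fun j => sin (x * ang j) / ang j) t)));
  [intros; ring|].
replace (locally 0) with (locally (2 * (0 + 0 * 0))) by (f_equal; ring).
repeat first [apply filterlim_Rplus|apply filterlim_Rmult|apply filterlim_const
  |apply pf_series_mul_t_limit|apply at_right_id|apply at_right_proper_filter].
- intros; apply cos_le_1.
- intros; apply pf_weight_sin_le.
Qed.

(* The constant [c] of [partial_fractions] never has to be computed: it is a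
   limit at [0] of a tame function. *)
Lemma tame_pf_total S M p : (0 < M)%nat -> (p <= M)%nat ->
  tame S M (fun t => expm1_div t * pf_total (INR p / INR M) t).
Proof.
intros HM Hp; set (x := INR p / INR M).
destruct (partial_fractions M p HM Hp) as [c Hc]; fold x in Hc.
assert (HB := tame_expm1_div S M HM).
assert (H1 := tame_plus _ _ _ _ (tame_exp S M p HM) (tame_opp _ _ _ HB)).
fold x in H1.
assert (HE : forall t, 0 < t -> exp (x * t) + -1 * expm1_div t =
  t * (c * expm1_div t + expm1_div t * (t * pf_total x t))).
{ intros t Ht; rewrite <- Hc by exact Ht; unfold expm1_div.
  assert (1 < exp t) by (rewrite <- exp_0; apply exp_increasing, Ht).
  field; split; lra. }
assert (HW := pf_total_mul_t_limit x).
(* First division by [t]: the numerator tends to [1 - 1]. The quotient tends to [c], and a second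
   division reaches [pf_total]. *)
apply (tame_div_t S M _ _ HM H1) in HE.
2: { replace (locally 0) with (locally (exp (x * 0) + -1 * 1))
       by (f_equal; rewrite Rmult_0_r, exp_0; ring).
     apply filterlim_Rplus; [apply at_right_proper_filter| |].
     - apply (filterlim_at_right_ex_derive (fun t => exp (x * t))); auto_derive; exact I.
     - apply filterlim_Rmult; [apply at_right_proper_filter|apply filterlim_const|].
       apply expm1_div_limit. }
destruct (tame_div S M _ c HM HE) as [Kc Hd].
{ replace (locally c) with (locally (c * 1 + 1 * 0)) by (f_equal; ring).
  repeat first [apply filterlim_Rplus|apply filterlim_Rmult|apply filterlim_const
    |apply HW|apply expm1_div_limit|apply at_right_proper_filter]. }
apply tame_ext with (3 := tame_plus _ _ _ _ Hd (tame_opp _ _ _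
  (tame_scal _ _ _ _ Kc (tame_expm1_div2 S M HM)))); [exact HM|].
intros t Ht; field; lra.
Qed.

Lemma trig_compl (M p : nat) (j : nat) : (0 < M)%nat -> (p <= M)%nat ->
  cos (INR (M - p) / INR M * ang j) = cos (INR p / INR M * ang j) /\
  sin (INR (M - p) / INR M * ang j) = - sin (INR p / INR M * ang j).
Proof.
intros HM Hp; assert (HM' := lt_0_INR _ HM).
replace (INR (M - p) / INR M * ang j) with
  (- (INR p / INR M * ang j) + 2 * INR (S j) * PI)
  by (rewrite minus_INR by lia; unfold ang; field; lra).
rewrite cos_period, sin_period, cos_neg, sin_neg; auto.
Qed.

(** Replacing [p] by [M - p] fixes the cosines and negates the sines, so the sum and the difference
    of the two totals separate them. The sine part carries an extra factor [t], which can be divided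
    out because the series is bounded. *)
Lemma tame_pf_cos_sin S M p : (0 < M)%nat -> (p <= M)%nat ->
  tame_pf S M (fun j => cos (INR p / INR M * ang j)) /\
  tame_pf S M (fun j => sin (INR p / INR M * ang j) / ang j).
Proof.
intros HM Hp; assert (H1 := tame_pf_total S M p HM Hp).
assert (H2 := tame_pf_total S M (M - p) HM ltac:(lia)).
set (u := pf_series (fun j => cos (INR p / INR M * ang j))).
set (v := pf_series (fun j => sin (INR p / INR M * ang j) / ang j)).
assert (E1 : forall t, pf_total (INR p / INR M) t = 2 * (u t + t * v t)) by reflexivity.
assert (E2 : forall t, pf_total (INR (M - p) / INR M) t = 2 * (u t - t * v t)).
{ intros t; unfold pf_total, u, v, pf_series.
  rewrite (Series_ext (fun j => cos (INR (M - p) / INR M * ang j) / (t ^ 2 + ang j ^ 2))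
    (fun j => cos (INR p / INR M * ang j) / (t ^ 2 + ang j ^ 2)))
    by (intros j; rewrite (proj1 (trig_compl M p j HM Hp)); reflexivity).
  rewrite (Series_ext (fun j => sin (INR (M - p) / INR M * ang j) / ang j / (t ^ 2 + ang j ^ 2))
    (fun j => -1 * (sin (INR p / INR M * ang j) / ang j / (t ^ 2 + ang j ^ 2)))).
  - rewrite Series_scal_l; ring.
  - intros j; rewrite (proj2 (trig_compl M p j HM Hp)); unfold Rdiv; ring. }
assert (K4 : subfield_gen S (/ INR 4)%R).
{ apply sfg_Rinv; [simpl; lra|apply sfg_INR]. }
split.
- apply tame_ext with (3 := tame_scal _ _ _ _ K4 (tame_plus _ _ _ _ H1 H2)); [exact HM|].
  intros t _; rewrite E1, E2; fold u; simpl; field.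
- apply tame_div_t with
    (2 := tame_scal _ _ _ _ K4 (tame_plus _ _ _ _ H1 (tame_opp _ _ _ H2)));
    [exact HM| |].
  + intros t _; rewrite E1, E2; fold v; simpl; field.
  + apply filterlim_at_right_ext with (fun t => expm1_div t * (t * v t)).
    * intros t _; rewrite E1, E2; simpl; field.
    * replace (locally 0) with (locally (1 * 0)) by (f_equal; ring).
      apply filterlim_Rmult; [apply at_right_proper_filter|apply expm1_div_limit|].
      apply pf_series_mul_t_limit; intros; apply pf_weight_sin_le.
Qed.

Lemma mero_pf_series S M w : (0 < M)%nat -> tame_pf S M w -> exists F,
  mero_field_gen (subfield_gen S) F /\
  forall t : R, 0 < t -> F t = RtoC (pf_series w (INR M * t)).
Proof.
intros HM [_ [F [HF HFe]]]; assert (HM' := lt_0_INR _ HM).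
destruct (tame_expm1_div S M HM) as [_ [G [HG HGe]]].
assert (HB : forall t, 0 < t -> expm1_div (INR M * t) <> 0).
{ intros t Ht; assert (0 < INR M * t) by (apply Rmult_lt_0_compat; lra).
  assert (1 < exp (INR M * t)) by (rewrite <- exp_0; apply exp_increasing; lra).
  apply Rgt_not_eq, Rdiv_lt_0_compat; lra. }
exists (fun t => F t * / G t)%C; split.
- apply mfg_mul; [exact HF|apply mfg_inv; [|exact HG]].
  apply (mero_eq_zero_false _ 1); [lra|]; intros t Ht; rewrite HGe by exact Ht.
  intros E; apply RtoC_inj in E; exact (HB t Ht E).
- intros t Ht; rewrite HFe, HGe by exact Ht.
  rewrite <- RtoC_inv, <- RtoC_mult by (apply HB, Ht); f_equal; field; apply HB, Ht.
Qed.

(** * Integration over the half-line *)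

Definition pf_primitive (M : nat) (w : nat -> R) (j : nat) (t : R) : R :=
  w j / ang j / INR M * atan (INR M / ang j * t).

Lemma pf_term_RInt (M : nat) (w : nat -> R) (j : nat) (u T : R) : (0 < M)%nat ->
  is_RInt (fun t => w j / ((INR M * t) ^ 2 + ang j ^ 2)) u T
    (pf_primitive M w j T - pf_primitive M w j u).
Proof.
intros HM; assert (HM' := lt_0_INR _ HM); assert (Ha := ang_ge_1 j).
assert (Hden : forall t, 0 < (INR M * t) ^ 2 + ang j ^ 2).
{ intros t; assert (0 <= (INR M * t) ^ 2) by apply pow2_ge_0; nra. }
apply (is_RInt_derive (V := R_CompleteNormedModule) (pf_primitive M w j)).
- intros t _; unfold pf_primitive.
  evar_last.
  + apply (is_derive_scal (fun t => atan (INR M / ang j * t))).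
    apply (is_derive_comp (V := R_NormedModule) atan (fun t => INR M / ang j * t));
      [apply is_derive_atan|].
    apply (is_derive_scal (fun t => t)), is_derive_id.
  + unfold scal, one; simpl; unfold mult; simpl; unfold Rsqr.
    specialize (Hden t); field; repeat split; nra.
- intros t _; apply (ex_derive_continuous (V := R_NormedModule)); auto_derive.
  apply Rgt_not_eq; specialize (Hden t); simpl in Hden; exact Hden.
Qed.

Lemma sum_n_RInt (f : nat -> R -> R) (l : nat -> R) (u T : R) (n : nat) :
  (forall j, is_RInt (f j) u T (l j)) ->
  is_RInt (fun t => sum_n (fun j => f j t) n) u T (sum_n l n).
Proof.
intros H; induction n as [|n IH].
- rewrite sum_O; apply is_RInt_ext with (2 := H 0%nat).
  intros t _; rewrite sum_O; reflexivity.
- rewrite sum_Sn; apply is_RInt_ext with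
    (fun t => plus (sum_n (fun j => f j t) n) (f (S n) t)).
  + intros t _; rewrite sum_Sn; reflexivity.
  + exact (is_RInt_plus (V := R_NormedModule) _ _ _ _ _ _ IH (H (S n))).
Qed.

Lemma pf_series_RInt (M : nat) (w : nat -> R) (u T : R) : (0 < M)%nat ->
  (forall j, Rabs (w j) <= 1) ->
  is_RInt (fun t => pf_series w (INR M * t)) u T
    (Series (fun j => pf_primitive M w j T - pf_primitive M w j u)).
Proof.
intros HM Hw.
destruct (filterlim_RInt (V := R_CompleteNormedModule) (U := nat)
  (fun n t => sum_n (fun j => w j / ((INR M * t) ^ 2 + ang j ^ 2)) n) u T
  eventually eventually_filter (fun t => pf_series w (INR M * t))
  (sum_n (fun j => pf_primitive M w j T - pf_primitive M w j u))) as [I [HI HR]].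
- intros n; apply (sum_n_RInt (fun j t => w j / ((INR M * t) ^ 2 + ang j ^ 2))).
  intros j; apply pf_term_RInt, HM.
- apply filterlim_locally; intros eps.
  destruct (series_tail_uniform _ eps ex_series_inv_sq (cond_pos eps)) as [n0 Hn0].
  exists n0; intros n Hn t.
  change (Rabs (sum_n (fun j => w j / ((INR M * t) ^ 2 + ang j ^ 2)) n -
    pf_series w (INR M * t)) < eps).
  rewrite Rabs_minus_sym; apply Hn0; [exact Hn|].
  intros j; apply pf_term_le, Hw.
- rewrite (is_series_unique _ I); [exact HR|exact HI].
Qed.

Lemma atan_lim_p (a : R) : 0 < a ->
  filterlim (fun t => atan (a * t)) (Rbar_locally p_infty) (locally (PI / 2)).
Proof.
intros Ha.
assert (H : is_lim (fun t => PI / 2 - atan (/ (a * t))) p_infty (PI / 2)).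
{ replace (Finite (PI / 2)) with (Finite (PI / 2 - atan 0))
    by (rewrite atan_0, Rminus_0_r; reflexivity).
  apply (is_lim_comp_continuous (fun t => / (a * t)) (fun v => PI / 2 - atan v)).
  - apply (is_lim_inv _ _ p_infty); [|discriminate].
    assert (H := is_lim_scal_l _ a p_infty p_infty (is_lim_id p_infty)).
    simpl in H; destruct (Rle_dec 0 a) as [H0|]; [|lra].
    destruct (Rle_lt_or_eq_dec 0 a H0); [exact H|lra].
  - apply (ex_derive_continuous (V := R_NormedModule)).
    auto_derive; exact I. }
apply filterlim_ext_loc with (2 := H).
exists 0; intros t Ht.
assert (0 < a * t) by (apply Rmult_lt_0_compat; lra).
rewrite atan_inv by assumption; ring.
Qed.

(** An integrated term has size [Rabs (w j) / ang j] only, so weights bounded by [1] would not give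
    a summable majorant; the bound [/ ang j] does, and this is where [n >= 1] comes from. *)
Lemma pf_series_improper (M : nat) (w : nat -> R) : (0 < M)%nat ->
  (forall j, Rabs (w j) <= / ang j) ->
  filterlim (fun ab : R * R =>
      Series (fun j => pf_primitive M w j (snd ab) - pf_primitive M w j (fst ab)))
    (filter_prod (at_right 0) (Rbar_locally p_infty))
    (locally (PI / (2 * INR M) * Series (fun j => w j / ang j))).
Proof.
intros HM Hw; assert (HM' := lt_0_INR _ HM).
assert (HM1 : 1 <= INR M) by (rewrite <- INR_1; apply le_INR, HM).
rewrite <- Series_scal_l.
assert (Hb : forall j v, Rabs v <= PI ->
  Rabs (w j / ang j / INR M * v) <= PI * / INR (S j) ^ 2).
{ intros j v Hv; assert (Ha := ang_ge j); assert (Ha1 := ang_ge_1 j).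
  assert (Hj := lt_0_INR (S j) ltac:(lia)).
  assert (Hi : 0 < / ang j <= / INR (S j))
    by (split; [apply Rinv_0_lt_compat|apply Rinv_le_contravar]; lra).
  assert (HiM : 0 < / INR M <= 1).
  { split; [apply Rinv_0_lt_compat; lra|].
    rewrite <- Rinv_1; apply Rinv_le_contravar; lra. }
  rewrite Rmult_comm, Rabs_mult.
  apply Rmult_le_compat; [apply Rabs_pos|apply Rabs_pos|exact Hv|].
  unfold Rdiv; rewrite !Rabs_mult, (Rabs_pos_eq (/ ang j)), (Rabs_pos_eq (/ INR M)) by lra.
  rewrite <- pow_inv; specialize (Hw j); pose proof (Rabs_pos (w j)).
  apply Rle_trans with (/ ang j * / ang j * 1).
  - apply Rmult_le_compat; [apply Rmult_le_pos| |apply Rmult_le_compat|]; lra.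
  - rewrite Rmult_1_r; replace ((/ INR (S j)) ^ 2) with (/ INR (S j) * / INR (S j)) by ring.
    apply Rmult_le_compat; lra. }
assert (HPI := PI_RGT_0).
apply (tannery (fun (ab : R * R) j => pf_primitive M w j (snd ab) - pf_primitive M w j (fst ab))
  _ (fun j => PI * / INR (S j) ^ 2)).
- apply (ex_series_scal (K := R_AbsRing) (V := R_NormedModule)), ex_series_inv_sq.
- intros j; pose proof (ang_ge_1 j).
  replace (PI / (2 * INR M) * (w j / ang j)) with (w j / ang j / INR M * (PI / 2))
    by (field; split; lra).
  apply Hb; rewrite Rabs_pos_eq; lra.
- apply filter_forall; intros [u T] j; unfold pf_primitive; simpl.
  rewrite <- Rmult_minus_distr_l; apply Hb.
  pose proof (atan_bound (INR M / ang j * u)); pose proof (atan_bound (INR M / ang j * T)).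
  apply Rabs_le; lra.
- intros j; pose proof (ang_ge_1 j).
  replace (PI / (2 * INR M) * (w j / ang j)) with
    (w j / ang j / INR M * (PI / 2) + -1 * (w j / ang j / INR M * atan 0))
    by (rewrite atan_0; field; split; lra).
  assert (HT : filterlim (fun ab : R * R => atan (INR M / ang j * snd ab))
    (filter_prod (at_right 0) (Rbar_locally p_infty)) (locally (PI / 2))).
  { apply (filterlim_comp _ _ _ snd (fun T => atan (INR M / ang j * T)) _ (Rbar_locally p_infty));
      [apply filterlim_snd|].
    apply atan_lim_p, Rdiv_lt_0_compat; lra. }
  assert (Hu : filterlim (fun ab : R * R => atan (INR M / ang j * fst ab))
    (filter_prod (at_right 0) (Rbar_locally p_infty)) (locally (atan 0))).
  { apply (filterlim_comp _ _ _ fst (fun u => atan (INR M / ang j * u)) _ (at_right 0));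
      [apply filterlim_fst|].
    rewrite <- (Rmult_0_r (INR M / ang j)) at 2.
    apply (filterlim_at_right_ex_derive (fun u => atan (INR M / ang j * u))).
    auto_derive; exact I. }
  apply filterlim_ext with (fun ab : R * R =>
    w j / ang j / INR M * atan (INR M / ang j * snd ab) +
    -1 * (w j / ang j / INR M * atan (INR M / ang j * fst ab)));
    [intros [u T]; unfold pf_primitive; simpl; ring|].
  apply filterlim_Rplus; [exact _|apply filterlim_Rmult; [exact _|apply filterlim_const|exact HT]|].
  apply filterlim_Rmult; [exact _|apply filterlim_const|].
  apply filterlim_Rmult; [exact _|apply filterlim_const|exact Hu].
Qed.

Lemma exponential_period_of_real (K : (C -> C) -> Prop) (F : C -> C)
  (h : R -> R) (G : R -> R -> R) (I : R) (c : C) :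
  K F -> (forall t : R, 0 < t -> F t = (c * RtoC (h t))%C) ->
  (forall u T, is_RInt h u T (G u T)) ->
  filterlim (fun ab : R * R => G (fst ab) (snd ab))
    (filter_prod (at_right 0) (Rbar_locally p_infty)) (locally I) ->
  exponential_period K (c * RtoC I)%C.
Proof.
intros HF HFh HG Hlim; exists F; split; [exact HF|].
set (Fl := filter_prod (at_right 0) (Rbar_locally p_infty)).
assert (HI : forall v, filterlim (fun ab : R * R => v * G (fst ab) (snd ab)) Fl (locally (v * I))).
{ intros v; apply filterlim_Rmult; [exact _|apply filterlim_const|exact Hlim]. }
intros P [eps HP].
assert (H1 := proj1 (filterlim_locally _ _) (HI (Re c)) eps).
assert (H2 := proj1 (filterlim_locally _ _) (HI (Im c)) eps).
(* [F] is known only at positive reals, so both endpoints are kept positive. *)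
assert (H3 : Fl (fun ab => 0 < fst ab /\ 0 < snd ab)).
{ apply Filter_prod with (fun u => 0 < u) (fun T => 0 < T).
  - exists (mkposreal 1 Rlt_0_1); auto.
  - exists 0; auto.
  - auto. }
change (Fl (fun ab => exists y,
  is_RInt (V := C_R_NormedModule) (fun t => F (RtoC t)) (fst ab) (snd ab) y /\ P y)).
generalize (filter_and _ _ H1 (filter_and _ _ H2 H3)); apply filter_imp.
intros [u T] [B1 [B2 [Hu HT]]]; simpl fst in *; simpl snd in *.
exists (Re c * G u T, Im c * G u T); split.
- apply is_RInt_ext with (fun t => (Re c * h t, Im c * h t)).
  + intros t [Ht _]; rewrite HFh.
    * destruct c as [c1 c2]; unfold RtoC, Cmult, Re, Im; simpl; f_equal; ring.
    * apply Rlt_trans with (2 := Ht); apply Rmin_glb_lt; assumption.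
  + apply (is_RInt_fct_extend_pair (U := R_NormedModule) (V := R_NormedModule));
      apply (is_RInt_scal (V := R_NormedModule)), HG.
- apply HP; replace (c * RtoC I)%C with (Re c * I, Im c * I).
  + split; assumption.
  + destruct c as [c1 c2]; unfold RtoC, Cmult, Re, Im; simpl; f_equal; ring.
Qed.

Lemma exponential_period_plus (K : C -> Prop) (x y : C) :
  exponential_period (mero_field_gen K) x ->
  exponential_period (mero_field_gen K) y ->
  exponential_period (mero_field_gen K) (x + y)%C.
Proof.
intros [F [HF Hx]] [G [HG Hy]]; exists (fun t => F t + G t)%C; split.
- apply mfg_add; assumption.
- exact (is_RInt_gen_plus (V := C_R_NormedModule) _ _ _ _ Hx Hy).
Qed.

Lemma exponential_period_pf_series S M w (c : C) : (0 < M)%nat ->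
  (forall j, Rabs (w j) <= / ang j) -> tame_pf S M w -> subfield_gen S c ->
  exponential_period (mero_field_gen (subfield_gen S))
    (c * RtoC (PI / (2 * INR M) * Series (fun j => (w j / ang j)%R)))%C.
Proof.
intros HM Hw Ht Hc; destruct (mero_pf_series S M w HM Ht) as [F [HF HFe]].
apply exponential_period_of_real with
  (F := fun t => (c * F t)%C) (h := fun t => pf_series w (INR M * t))
  (G := fun u T => Series (fun j => pf_primitive M w j T - pf_primitive M w j u)).
- apply mfg_mul; [apply mfg_const, Hc|exact HF].
- intros t Ht0; rewrite HFe by exact Ht0; reflexivity.
- intros u T; apply pf_series_RInt; [exact HM|].
  intros j; apply Rle_trans with (1 := Hw j).
  rewrite <- Rinv_1; apply Rinv_le_contravar; [lra|apply ang_ge_1].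
- apply pf_series_improper; assumption.
Qed.

(** * Trigonometric series of given parity *)

Definition trig (n : nat) (u : R) : R := if Nat.even n then cos u else sin u.

Lemma trig_SS n u : trig (S (S n)) u = trig n u.
Proof. reflexivity. Qed.

Lemma trig_le_1 n u : Rabs (trig n u) <= 1.
Proof. unfold trig; destruct (Nat.even n); [apply cos_le_1|apply sin_le_1]. Qed.

Lemma trig_weight_le n u j : Rabs (trig n u / ang j ^ n) <= 1.
Proof.
unfold Rdiv; rewrite Rabs_mult.
assert (1 <= ang j ^ n) by apply pow_R1_Rle, ang_ge_1.
assert (0 < / ang j ^ n <= 1).
{ split; [apply Rinv_0_lt_compat; lra|].
  rewrite <- Rinv_1; apply Rinv_le_contravar; lra. }
rewrite (Rabs_pos_eq (/ _)) by lra.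
pose proof (trig_le_1 n u); pose proof (Rabs_pos (trig n u)); nra.
Qed.

Lemma tame_pf_ext S M w w' : (0 < M)%nat -> (forall j, w j = w' j) ->
  tame_pf S M w -> tame_pf S M w'.
Proof.
intros HM H; apply tame_ext; [exact HM|]; intros t _; f_equal.
apply Series_ext; intros j; rewrite H; reflexivity.
Qed.

Lemma tame_pf_trig S M p n : (0 < M)%nat -> (p <= M)%nat ->
  tame_pf S M (fun j => trig n (INR p / INR M * ang j) / ang j ^ n).
Proof.
intros HM Hp; set (x := INR p / INR M).
(* Division by [ang j ^ 2] raises [n] by two and preserves the kind of function, so the induction
   carries two consecutive values, with cosine and sine as base cases. *)
assert (H : tame_pf S M (fun j => trig n (x * ang j) / ang j ^ n) /\
  tame_pf S M (fun j => trig (1 + n) (x * ang j) / ang j ^ (1 + n))).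
{ induction n as [|n [IH0 IH1]].
  - destruct (tame_pf_cos_sin S M p HM Hp) as [H0 H1]; split.
    + apply tame_pf_ext with (3 := H0); [exact HM|].
      intros j; unfold trig; simpl; fold x; field.
    + apply tame_pf_ext with (3 := H1); [exact HM|].
      intros j; unfold trig; simpl; fold x; rewrite Rmult_1_r; reflexivity.
  - split; [exact IH1|].
    apply tame_pf_ext with (3 := tame_pf_div_sq S M _ HM
      (fun j => trig_weight_le n (x * ang j) j) IH0); [exact HM|].
    intros j; rewrite trig_SS; pose proof (ang_ge_1 j).
    simpl; field; split; [apply pow_nonzero|]; lra. }
apply H.
Qed.

Definition trig_series (n M p : nat) : R :=
  Series (fun j => trig n (INR p / INR M * ang j) * / INR (S j) ^ (n + 1)).

Lemma ex_trig_series n M p : (1 <= n)%nat ->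
  ex_series (fun j => trig n (INR p / INR M * ang j) * / INR (S j) ^ (n + 1)).
Proof.
intros Hn; apply ex_series_bound with (2 := ex_series_inv_sq); intros j.
assert (1 <= INR (S j)) by (rewrite S_INR; pose proof (pos_INR j); lra).
rewrite Rabs_mult, (Rabs_pos_eq (/ _))
  by (left; apply Rinv_0_lt_compat, pow_lt; lra).
rewrite <- (Rmult_1_l (/ INR (S j) ^ 2)).
apply Rmult_le_compat; [apply Rabs_pos| |apply trig_le_1|].
- left; apply Rinv_0_lt_compat, pow_lt; lra.
- apply Rinv_le_contravar; [apply pow_lt; lra|apply Rle_pow; [lra|lia]].
Qed.

Lemma exponential_period_trig_series A M p n (c : C) :
  (0 < M)%nat -> (p <= M)%nat -> (1 <= n)%nat -> subfield_gen A c ->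
  exponential_period (mero_field_gen (subfield_gen A))
    (c * RtoC (trig_series n M p / PI ^ n))%C.
Proof.
intros HM Hp Hn Hc; assert (HM' := lt_0_INR _ HM); assert (HPI := PI_RGT_0).
set (w := fun j => trig n (INR p / INR M * ang j) / ang j ^ n).
(* Origin of the constant: [ang j ^ (n + 1)] contributes [(2 PI)^(n+1)] to the denominator and the
   integral contributes [PI / (2 M)], which leaves [M 2^(n+2) PI^n] in the denominator. *)
assert (HE : (c * RtoC (trig_series n M p / PI ^ n))%C =
  (c * RtoC (INR M * INR 2 ^ (n + 2)) *
   RtoC (PI / (2 * INR M) * Series (fun j => (w j / ang j)%R)))%C).
{ rewrite <- Cmult_assoc, <- RtoC_mult; f_equal; f_equal.
  unfold trig_series.
  rewrite (Series_ext (fun j => w j / ang j) (fun j => / (2 * PI) ^ (n + 1) *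
    (trig n (INR p / INR M * ang j) * / INR (S j) ^ (n + 1)))).
  - rewrite Series_scal_l, !pow_add, Rpow_mult_distr.
    assert (0 < PI ^ n) by (apply pow_lt; lra).
    assert (0 < 2 ^ n) by (apply pow_lt; lra).
    change (INR 2) with 2; simpl; field; repeat split; lra.
  - intros j; unfold w; assert (Hj := lt_0_INR (S j) ltac:(lia)).
    assert (Ha : ang j = 2 * PI * INR (S j)) by reflexivity.
    set (tr := trig n (INR p / INR M * ang j)).
    rewrite !Ha, !Nat.add_1_r, !Rpow_mult_distr.
    assert (0 < PI ^ n) by (apply pow_lt; lra).
    assert (0 < 2 ^ n) by (apply pow_lt; lra).
    assert (0 < INR (S j) ^ n) by (apply pow_lt; lra).
    rewrite <- !tech_pow_Rmult; field; repeat split; lra. }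
rewrite HE; apply exponential_period_pf_series; [exact HM| |apply tame_pf_trig; assumption|].
- intros j; unfold w, Rdiv; rewrite Rabs_mult; pose proof (ang_ge_1 j).
  rewrite (Rabs_pos_eq (/ _)) by (left; apply Rinv_0_lt_compat, pow_lt; lra).
  rewrite <- (Rmult_1_l (/ ang j)).
  apply Rmult_le_compat; [apply Rabs_pos| |apply trig_le_1|].
  + left; apply Rinv_0_lt_compat, pow_lt; lra.
  + apply Rinv_le_contravar; [lra|].
    rewrite <- (pow_1 (ang j)) at 1; apply Rle_pow; assumption.
- apply sfg_mul; [exact Hc|]; apply sfg_Rmult; [apply sfg_INR|].
  apply sfg_Rpow, sfg_INR.
Qed.

(** * Roots of unity *)

Fixpoint csum (f : nat -> C) (n : nat) : C :=
  match n with O => 0%C | S k => (csum f k + f (S k))%C end.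

Lemma csum_ext_loc f g n :
  (forall k, (1 <= k <= n)%nat -> f k = g k) -> csum f n = csum g n.
Proof.
induction n as [|n IH]; intros H; simpl; [reflexivity|].
rewrite IH by (intros; apply H; lia); rewrite H by lia; reflexivity.
Qed.

Lemma csum_plus f g n : csum (fun k => f k + g k)%C n = (csum f n + csum g n)%C.
Proof. induction n as [|n IH]; simpl; [ring|]. rewrite IH; ring. Qed.

Lemma csum_scal c f n : csum (fun k => c * f k)%C n = (c * csum f n)%C.
Proof. induction n as [|n IH]; simpl; [ring|]. rewrite IH; ring. Qed.

Lemma csum_zero n : csum (fun _ => 0%C) n = 0%C.
Proof. induction n as [|n IH]; simpl; [reflexivity|]. rewrite IH; ring. Qed.

Lemma csum_switch (f : nat -> nat -> C) m n :
  csum (fun j => csum (f j) n) m = csum (fun k => csum (fun j => f j k) m) n.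
Proof.
induction m as [|m IH]; simpl.
- symmetry; apply csum_zero.
- rewrite IH, <- csum_plus; reflexivity.
Qed.

Lemma csum_single (f : nat -> C) n k0 :
  (1 <= k0 <= n)%nat -> (forall k, (1 <= k <= n)%nat -> k <> k0 -> f k = 0%C) ->
  csum f n = f k0.
Proof.
intros Hk H; induction n as [|n IH]; [lia|]; simpl.
destruct (Nat.eq_dec (S n) k0) as [<-|Hne].
- rewrite (csum_ext_loc _ (fun _ => 0%C)) by (intros; apply H; lia).
  rewrite csum_zero; ring.
- rewrite IH by (try lia; intros; apply H; lia).
  rewrite (H (S n)) by lia; ring.
Qed.

Lemma csum_RtoC f n : csum (fun k => RtoC (f k)) n = RtoC (rsum f n).
Proof.
induction n as [|n IH]; simpl; [reflexivity|].
rewrite IH, RtoC_plus; reflexivity.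
Qed.

Lemma sfg_csum A f n : (forall k, subfield_gen A (f k)) -> subfield_gen A (csum f n).
Proof. intros H; induction n as [|n IH]; [apply sfg_zero|apply sfg_add; auto]. Qed.

Lemma csum_pow_root (u : C) (N : nat) : (u ^ N = 1)%C -> u <> 1%C ->
  csum (fun l => u ^ l)%C N = 0%C.
Proof.
intros Hu Hu1.
assert (H : forall n, ((1 - u) * csum (fun l => u ^ l)%C n = u - u * u ^ n)%C).
{ induction n as [|n IH]; simpl; [ring|].
  rewrite Cmult_plus_distr_l, IH; simpl; ring. }
specialize (H N); rewrite Hu in H.
assert (H1 : (1 - u <> 0)%C).
{ intros E; apply Hu1; replace u with (1 - (1 - u))%C by ring; rewrite E; ring. }
replace (csum (fun l => u ^ l)%C N) with (/ (1 - u) * ((1 - u) * csum (fun l => u ^ l)%C N))%C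
  by (field; exact H1).
rewrite H; ring.
Qed.

(* Otherwise the double sum of [(w zeta^k)^l] over [1 <= k, l <= N] vanishes when
   summed over [l] first, and equals [N] when summed over [k] first. *)
Lemma root_of_unity_is_power (N : nat) (zeta w : C) :
  (0 < N)%nat -> primitive_root_of_unity N zeta -> (w ^ N = 1)%C ->
  exists k, w = (zeta ^ k)%C.
Proof.
intros HN [Hz Hprim] Hw; apply NNPP; intros Hne.
assert (Hzk : forall k, ((zeta ^ k) ^ N = 1)%C).
{ intros k; rewrite <- Cpow_mult_r, Nat.mul_comm, Cpow_mult_r, Hz; apply Cpow_1_l. }
assert (H1 : csum (fun k => csum (fun l => (w * zeta ^ k) ^ l)%C N) N = 0%C).
{ rewrite (csum_ext_loc _ (fun _ => 0%C)); [apply csum_zero|].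
  intros k Hk; apply csum_pow_root; [rewrite Cpow_mult_l, Hw, Hzk; ring|].
  intros E; apply Hne; exists (N - k)%nat.
  transitivity (w * zeta ^ N)%C; [rewrite Hz; ring|].
  replace N with (k + (N - k))%nat at 1 by lia.
  rewrite Cpow_add_r, Cmult_assoc, E; ring. }
rewrite csum_switch, (csum_single _ _ N) in H1; [|lia|].
- rewrite (csum_ext_loc _ (fun _ => RtoC 1)) in H1.
  + rewrite csum_RtoC, rsum_const in H1.
    apply RtoC_inj in H1; apply lt_0_INR in HN; lra.
  + intros k _; rewrite Cpow_mult_l, Hw, Hzk; ring.
- intros l Hl Hlk.
  rewrite (csum_ext_loc _ (fun k => w ^ l * (zeta ^ l) ^ k)%C).
  + rewrite csum_scal, csum_pow_root; [ring|apply Hzk|apply Hprim; lia].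
  + intros k _; rewrite Cpow_mult_l, <- !Cpow_mult_r, (Nat.mul_comm k l); reflexivity.
Qed.

Definition cis (u : R) : C := (cos u, sin u).

Lemma cis_pow (u : R) (n : nat) : (cis u ^ n)%C = cis (INR n * u).
Proof.
induction n as [|n IH].
- unfold cis; simpl; rewrite Rmult_0_l, cos_0, sin_0; reflexivity.
- change (cis u ^ S n)%C with (cis u * cis u ^ n)%C; rewrite IH, S_INR.
  replace ((INR n + 1) * u) with (u + INR n * u) by ring.
  unfold cis, Cmult; simpl; rewrite cos_plus, sin_plus; f_equal; ring.
Qed.

Lemma cis_2PI (n : nat) : cis (2 * INR n * PI) = 1%C.
Proof.
unfold cis; rewrite <- (Rplus_0_l (2 * INR n * PI)), cos_period, sin_period.
rewrite cos_0, sin_0; reflexivity.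
Qed.

(** An arbitrary primitive root [zeta] has [exp (2 PI i / (4 M))] among its powers. The factor [4]
    puts [i] in the field, which is what extracts a real sine from a difference of conjugates. *)
Lemma sfg_cos_sin A (M q : nat) (zeta : C) :
  (0 < M)%nat -> primitive_root_of_unity (4 * M) zeta -> A zeta ->
  subfield_gen A (cos (2 * PI * INR q / INR M)) /\
  subfield_gen A (sin (2 * PI * INR q / INR M)).
Proof.
intros HM Hz HA; assert (HM' := lt_0_INR _ HM).
set (e := cis (2 * PI / INR (4 * M))).
assert (H4 : INR (4 * M) = 4 * INR M) by (rewrite mult_INR; simpl; ring).
assert (He : subfield_gen A e).
{ destruct (root_of_unity_is_power (4 * M) zeta e) as [k ->]; [lia|exact Hz| |].
  - unfold e; rewrite cis_pow, <- (cis_2PI 1); f_equal; rewrite H4; simpl; field; lra.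
  - apply sfg_pow, sfg_mem, HA. }
set (th := 2 * PI * INR q / INR M).
assert (Hp : subfield_gen A (cis th)).
{ replace (cis th) with (e ^ (4 * q))%C; [apply sfg_pow, He|].
  unfold e, th; rewrite cis_pow, H4, mult_INR; f_equal; simpl; field; lra. }
assert (Hm : subfield_gen A (cis (- th))).
(* A nonnegative exponent congruent to [- 4 q] modulo [4 M]. *)
{ replace (cis (- th)) with (e ^ (4 * (q * (M - 1))))%C; [apply sfg_pow, He|].
  unfold e, th; rewrite cis_pow, H4, !mult_INR, minus_INR by lia.
  replace (INR 4 * (INR q * (INR M - INR 1)) * (2 * PI / (4 * INR M)))
    with (- (2 * PI * INR q / INR M) + 2 * INR q * PI) by (simpl; field; lra).
  unfold cis; rewrite cos_period, sin_period; reflexivity. }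
assert (Hi : subfield_gen A Ci).
{ replace Ci with (e ^ M)%C; [apply sfg_pow, He|].
  unfold e; rewrite cis_pow, H4.
  replace (INR M * (2 * PI / (4 * INR M))) with (PI / 2) by (field; lra).
  unfold cis; rewrite cos_PI2, sin_PI2; reflexivity. }
assert (H2 : subfield_gen A (/ 2)%R).
{ apply sfg_Rinv; [lra|exact (sfg_INR A 2)]. }
split.
- replace (RtoC (cos th)) with ((cis th + cis (- th)) * RtoC (/ 2))%C.
  + apply sfg_mul; [apply sfg_add|]; assumption.
  + unfold cis, RtoC, Cmult, Cplus; simpl; rewrite cos_neg, sin_neg; f_equal; field.
- replace (RtoC (sin th)) with ((cis (- th) + - cis th) * RtoC (/ 2) * Ci)%C.
  + apply sfg_mul; [apply sfg_mul|]; try assumption.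
    apply sfg_add; [|apply sfg_opp]; assumption.
  + unfold cis, RtoC, Cmult, Cplus, Copp, Ci; simpl; rewrite cos_neg, sin_neg; f_equal; field.
Qed.

(** * Discrete Fourier expansion of a periodic function of given parity *)

(** The product formula for two cosines or two sines gives the sign. The sum of the indices is
    written with a double minus so that both conditions have the shape used in [csum_residue]. *)
Lemma trig_orthogonality (n M i j : nat) : (0 < M)%nat ->
  rsum (fun p => trig n (INR p / INR M * ang i) * trig n (INR p / INR M * ang j)) M =
  INR M / 2 *
   ((if Zdivide_dec (Z.of_nat M) (Z.of_nat (S i) - Z.of_nat (S j)) then 1 else 0) +
    (if Nat.even n then 1 else -1) *
    (if Zdivide_dec (Z.of_nat M) (Z.of_nat (S i) - - Z.of_nat (S j)) then 1 else 0)).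
Proof.
intros HM; assert (HM' := lt_0_INR _ HM).
set (sg := if Nat.even n then 1 else -1).
set (d1 := (Z.of_nat (S i) - Z.of_nat (S j))%Z).
set (d2 := (Z.of_nat (S i) - - Z.of_nat (S j))%Z).
rewrite (rsum_ext_loc _ (fun p => / 2 * cos (INR p * (2 * PI * IZR d1 / INR M)) +
  / 2 * sg * cos (INR p * (2 * PI * IZR d2 / INR M)))).
- rewrite rsum_plus, !rsum_scal, !sum_cos_full by exact HM.
  destruct (Zdivide_dec (Z.of_nat M) d1); destruct (Zdivide_dec (Z.of_nat M) d2);
    field.
- intros p _.
  replace (INR p * (2 * PI * IZR d1 / INR M)) with
    (INR p / INR M * ang i - INR p / INR M * ang j)
    by (unfold d1, ang; rewrite minus_IZR, <- !INR_IZR_INZ; field; lra).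
  replace (INR p * (2 * PI * IZR d2 / INR M)) with
    (INR p / INR M * ang i + INR p / INR M * ang j)
    by (unfold d2, ang; rewrite minus_IZR, opp_IZR, <- !INR_IZR_INZ; field; lra).
  rewrite cos_minus, cos_plus; unfold trig, sg; destruct (Nat.even n); field.
Qed.

Lemma periodic_mult (f : Z -> C) (M : nat) :
  (forall k, f (k + Z.of_nat M)%Z = f k) ->
  forall k q, f (k + q * Z.of_nat M)%Z = f k.
Proof.
intros Hf.
assert (Hn : forall (q : nat) k, f (k + Z.of_nat q * Z.of_nat M)%Z = f k).
{ induction q as [|q IH]; intros k; [f_equal; lia|].
  rewrite <- (IH k), <- (Hf (k + Z.of_nat q * Z.of_nat M)%Z); f_equal; lia. }
intros k q; destruct (Z_le_gt_dec 0 q) as [Hq|Hq].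
- rewrite <- (Z2Nat.id q) by exact Hq; apply Hn.
- rewrite <- (Hn (Z.to_nat (- q)) (k + q * Z.of_nat M)%Z); f_equal.
  rewrite Z2Nat.id by lia; lia.
Qed.

Lemma csum_residue (f : Z -> C) (M : nat) (d : Z) : (0 < M)%nat ->
  (forall k, f (k + Z.of_nat M)%Z = f k) ->
  csum (fun s => f (Z.of_nat s) *
    RtoC (if Zdivide_dec (Z.of_nat M) (Z.of_nat s - d) then 1 else 0))%C M = f d.
Proof.
intros HM Hf.
(* The sum runs over [1..M], not [0..M-1], so the representative of [d] is [(d - 1) mod M + 1]. *)
assert (Hb := Z.mod_pos_bound (d - 1) (Z.of_nat M) ltac:(lia)).
assert (Hd := Z.div_mod (d - 1) (Z.of_nat M) ltac:(lia)).
set (r := ((d - 1) mod Z.of_nat M)%Z) in *; set (q := ((d - 1) / Z.of_nat M)%Z) in *.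
rewrite (csum_single _ _ (Z.to_nat (r + 1))); [|lia|].
- rewrite Z2Nat.id by lia.
  destruct (Zdivide_dec (Z.of_nat M) (r + 1 - d)) as [_|Hn].
  + rewrite <- (periodic_mult f M Hf (r + 1) q).
    replace (r + 1 + q * Z.of_nat M)%Z with d by lia; ring.
  + exfalso; apply Hn; exists (- q)%Z; lia.
- intros s Hs Hne; destruct (Zdivide_dec (Z.of_nat M) (Z.of_nat s - d)) as [[t Ht]|_]; [|ring].
  exfalso; apply Hne.
  assert (t + q = 0)%Z by nia.
  nia.
Qed.

Definition fourier_coef (f : Z -> C) (n M p : nat) : C :=
  csum (fun s => f (Z.of_nat s) *
    RtoC (trig n (INR p / INR M * ang (pred s)) / INR M))%C M.

(** Orthogonality alone recovers only the average of [f j] and [f (- j)] with the sign of [n]; the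
    parity of [f] makes the two terms equal. *)
Lemma fourier_expansion (f : Z -> C) (n M j : nat) : (0 < M)%nat ->
  (forall k, f (k + Z.of_nat M)%Z = f k) ->
  (forall k, f (- k)%Z = (RtoC (if Nat.even n then 1 else -1) * f k)%C) ->
  f (Z.of_nat (S j)) =
  csum (fun p => fourier_coef f n M p * RtoC (trig n (INR p / INR M * ang j)))%C M.
Proof.
intros HM Hf Hpar; assert (HM' := lt_0_INR _ HM); symmetry.
set (sg := if Nat.even n then 1 else -1) in *.
set (ind := fun s d => if Zdivide_dec (Z.of_nat M) (Z.of_nat s - d) then 1 else 0).
transitivity (csum (fun s => f (Z.of_nat s) * RtoC (/ INR M *
  rsum (fun p => (trig n (INR p / INR M * ang (pred s)) *
                  trig n (INR p / INR M * ang j))%R) M))%C M).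
{ unfold fourier_coef.
  rewrite (csum_ext_loc _ (fun p => csum (fun s =>
    f (Z.of_nat s) * RtoC (/ INR M * (trig n (INR p / INR M * ang (pred s)) *
                 trig n (INR p / INR M * ang j))))%C M)).
  - rewrite csum_switch; apply csum_ext_loc; intros s _.
    rewrite csum_scal, csum_RtoC, rsum_scal; reflexivity.
  - intros p _; rewrite Cmult_comm, <- csum_scal; apply csum_ext_loc; intros s _.
    unfold Rdiv; rewrite !RtoC_mult; ring. }
transitivity (csum (fun s => RtoC (/ 2) * (f (Z.of_nat s) * RtoC (ind s (Z.of_nat (S j)))) +
  RtoC (/ 2 * sg) * (f (Z.of_nat s) * RtoC (ind s (- Z.of_nat (S j))%Z)))%C M).
{ apply csum_ext_loc; intros [|s] Hs; [lia|].
  simpl pred; rewrite trig_orthogonality by exact HM.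
  fold sg; fold (ind (S s) (Z.of_nat (S j))); fold (ind (S s) (- Z.of_nat (S j))%Z).
  set (i1 := ind _ _); set (i2 := ind _ _).
  replace (/ INR M * (INR M / 2 * (i1 + sg * i2))) with (/ 2 * i1 + / 2 * sg * i2)
    by (field; lra).
  rewrite RtoC_plus, !RtoC_mult; ring. }
rewrite csum_plus, !csum_scal; unfold ind; rewrite !csum_residue, Hpar by assumption.
rewrite Cmult_assoc, <- RtoC_mult, <- Cmult_plus_distr_r, <- RtoC_plus.
replace (/ 2 + / 2 * sg * sg) with 1 by (unfold sg; destruct (Nat.even n); field).
ring.
Qed.

(** * Complex series and the Euler factors *)

Definition is_cseries (a : nat -> C) (l : C) : Prop :=
  is_series (fun k => Re (a k)) (Re l) /\ is_series (fun k => Im (a k)) (Im l).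

Lemma is_cseries_CSeries a l : is_cseries a l -> CSeries a = l.
Proof.
intros [H1 H2]; unfold CSeries; destruct l as [x y].
rewrite (is_series_unique _ _ H1), (is_series_unique _ _ H2); reflexivity.
Qed.

Lemma is_cseries_ext a b l : (forall k, a k = b k) -> is_cseries a l -> is_cseries b l.
Proof.
intros H [H1 H2]; split;
  [apply is_series_ext with (2 := H1)|apply is_series_ext with (2 := H2)];
  intros k; rewrite H; reflexivity.
Qed.

Lemma is_cseries_plus a b la lb : is_cseries a la -> is_cseries b lb ->
  is_cseries (fun k => a k + b k)%C (la + lb)%C.
Proof.
intros [H1 H2] [H3 H4]; split.
- exact (is_series_plus (V := R_NormedModule) _ _ _ _ H1 H3).
- exact (is_series_plus (V := R_NormedModule) _ _ _ _ H2 H4).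
Qed.

Lemma is_cseries_scal c a l : is_cseries a l -> is_cseries (fun k => c * a k)%C (c * l)%C.
Proof.
intros [H1 H2].
assert (Hs := fun v b m => is_series_scal (K := R_AbsRing) (V := R_NormedModule) v b m).
split.
- exact (is_series_minus (V := R_NormedModule) _ _ _ _
    (Hs (Re c) _ _ H1) (Hs (Im c) _ _ H2)).
- exact (is_series_plus (V := R_NormedModule) _ _ _ _
    (Hs (Re c) _ _ H2) (Hs (Im c) _ _ H1)).
Qed.

Lemma is_series_zero : is_series (fun _ : nat => 0) 0.
Proof.
intros P HP; exists 0%nat; intros n _; rewrite sum_n_const, Rmult_0_r.
exact (locally_singleton _ _ HP).
Qed.

Lemma is_cseries_RtoC a : ex_series a -> is_cseries (fun k => RtoC (a k)) (RtoC (Series a)).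
Proof.
intros Ha; split; [exact (Series_correct _ Ha)|apply is_series_zero].
Qed.

Lemma is_cseries_csum (a : nat -> nat -> C) (l : nat -> C) (n : nat) :
  (forall p, (1 <= p <= n)%nat -> is_cseries (fun k => a k p) (l p)) ->
  is_cseries (fun k => csum (a k) n) (csum l n).
Proof.
induction n as [|n IH]; intros H; simpl.
- split; apply is_series_zero.
- apply is_cseries_plus; [apply IH; intros; apply H; lia|apply H; lia].
Qed.

(** Inserting zeros only delays the partial sums: the one up to [n] equals the original one up to
    [n / p]. *)
Lemma is_series_multiples (a : nat -> R) (p : nat) (l : R) : (0 < p)%nat ->
  is_series (fun k => a (p * S k)%nat) l ->
  is_series (fun k => if Zdivide_dec (Z.of_nat p) (Z.of_nat (S k)) then a (S k) else 0) l.
Proof.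
intros Hp H.
set (b := fun k => if Zdivide_dec (Z.of_nat p) (Z.of_nat k) then a k else 0).
assert (Hsum : forall n, rsum b n = rsum (fun k => a (p * k)%nat) (n / p)).
{ induction n as [|n IH]; [rewrite Nat.div_small by lia; reflexivity|].
  cbn [rsum]; rewrite IH; unfold b.
  assert (Hn := Nat.div_mod n p ltac:(lia)); assert (Hr := Nat.mod_upper_bound n p ltac:(lia)).
  destruct (Zdivide_dec (Z.of_nat p) (Z.of_nat (S n))) as [[q Hq]|Hd].
  - assert (E1 : S n = (p * Z.to_nat q)%nat) by nia.
    assert (E2 : Z.to_nat q = S (n / p)) by nia.
    rewrite E1, Nat.mul_comm, Nat.div_mul, Nat.mul_comm, E2 by lia; reflexivity.
  - rewrite Rplus_0_r; f_equal.
    destruct (Nat.eq_dec (n mod p) (p - 1)) as [E|E].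
    + exfalso; apply Hd; exists (Z.of_nat (S (n / p))); nia.
    + apply (Nat.div_unique _ _ _ (S (n mod p))); lia. }
assert (Hrs : forall (c : nat -> R) n, sum_n (fun k => c (S k)) n = rsum c (S n)).
{ intros c n; induction n as [|n IH]; [rewrite sum_O; simpl; ring|].
  rewrite sum_Sn, IH; reflexivity. }
assert (H' : filterlim (rsum (fun k => a (p * k)%nat)) eventually (locally l)).
{ apply (is_lim_seq_incr_1 (rsum (fun k => a (p * k)%nat)) l).
  apply (is_lim_seq_ext (sum_n (fun k => a (p * S k)%nat))); [|exact H].
  intros n; apply (Hrs (fun k => a (p * k)%nat)). }
change (is_series (fun k => b (S k)) l); unfold is_series.
apply filterlim_ext with (fun n => rsum (fun k => a (p * k)%nat) (S n / p)).
{ intros n; rewrite <- Hsum; symmetry; apply Hrs. }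
apply (filterlim_comp _ _ _ (fun n => S n / p)%nat _ _ eventually); [|exact H'].
intros P [N HN]; exists (p * N)%nat; intros n Hn; apply HN.
apply Nat.div_le_lower_bound; lia.
Qed.

Lemma is_cseries_multiples (a : nat -> C) (p : nat) (l : C) : (0 < p)%nat ->
  is_cseries (fun k => a (p * S k)%nat) l ->
  is_cseries (fun k => if Zdivide_dec (Z.of_nat p) (Z.of_nat (S k)) then a (S k) else 0%C) l.
Proof.
intros Hp [H1 H2]; split.
- apply is_series_ext with (2 := is_series_multiples (fun k => Re (a k)) p _ Hp H1).
  intros k; destruct (Zdivide_dec _ _); reflexivity.
- apply is_series_ext with (2 := is_series_multiples (fun k => Im (a k)) p _ Hp H2).
  intros k; destruct (Zdivide_dec _ _); reflexivity.
Qed.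

(** Built one prime at a time, so that each layer multiplies the Dirichlet series by one Euler
    factor. *)
Fixpoint sieve (l : list Z) (f : Z -> C) (k : Z) : C :=
  match l with
  | nil => f k
  | (p :: l')%list => if Zdivide_dec p k then 0%C else sieve l' f k
  end.

Lemma sieve_cases l f k : sieve l f k = 0%C \/ sieve l f k = f k.
Proof.
induction l as [|p l IH]; simpl; [right; reflexivity|].
destruct (Zdivide_dec p k); [left; reflexivity|exact IH].
Qed.

Lemma sieve_mult l f : (forall p, In p l -> prime p) ->
  (forall j k, f (j * k)%Z = f j * f k)%C ->
  forall j k, (sieve l f (j * k)%Z = sieve l f j * sieve l f k)%C.
Proof.
intros Hl Hf j k; induction l as [|p l IH]; simpl; [apply Hf|].
assert (IH' := IH (fun q Hq => Hl q (or_intror Hq))).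
destruct (Zdivide_dec p (j * k)) as [H|H].
- destruct (prime_mult p (Hl p (or_introl eq_refl)) _ _ H);
    destruct (Zdivide_dec p j); destruct (Zdivide_dec p k); try contradiction; ring.
- destruct (Zdivide_dec p j) as [Hj|_]; [exfalso; apply H, Z.divide_mul_l, Hj|].
  destruct (Zdivide_dec p k) as [Hk|_]; [exfalso; apply H, Z.divide_mul_r, Hk|].
  exact IH'.
Qed.

Definition dseries_term (f : Z -> C) (s : nat) (k : nat) : C :=
  (f (Z.of_nat k) * RtoC (/ INR k ^ s))%C.

Lemma euler_factors A (f : Z -> C) (s : nat) (L : C) (l : list Z) :
  (forall p, In p l -> prime p) ->
  (forall j k, f (j * k)%Z = f j * f k)%C ->
  (forall k, subfield_gen A (f k)) ->
  is_cseries (fun k => dseries_term f s (S k)) L ->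
  exists E, subfield_gen A E /\
    is_cseries (fun k => dseries_term (sieve l f) s (S k)) (E * L)%C.
Proof.
intros Hl Hf HA HL; induction l as [|p l IH].
- exists 1%C; split; [apply sfg_one|]; rewrite Cmult_1_l; exact HL.
- destruct IH as [E [HE HS]]; [intros q Hq; apply Hl; right; exact Hq|].
  assert (Hp := Hl p (or_introl eq_refl)); assert (Hp2 := prime_ge_2 p Hp).
  set (g := sieve l f) in *.
  assert (Hg := sieve_mult l f (fun q Hq => Hl q (or_intror Hq)) Hf); fold g in Hg.
  set (P := Z.to_nat p); assert (HP : Z.of_nat P = p) by (unfold P; lia).
  assert (HP0 : (0 < P)%nat) by lia.
  set (c := (g p * RtoC (/ INR P ^ s))%C).
  assert (Hc : subfield_gen A c).
  { apply sfg_mul.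
    - unfold g; destruct (sieve_cases l f p) as [->| ->]; [apply sfg_zero|apply HA].
    - apply sfg_Rinv; [apply pow_nonzero, not_0_INR; lia|apply sfg_Rpow, sfg_INR]. }
  (* By complete multiplicativity the terms at multiples of [p] form [c] times the whole series;
     removing them multiplies the sum by [1 - c]. *)
  assert (HM : is_cseries (fun k => dseries_term g s (P * S k)) (c * (E * L))%C).
  { apply is_cseries_ext with (2 := is_cseries_scal c _ _ HS).
    intros k; unfold dseries_term, c.
    rewrite Nat2Z.inj_mul, HP, Hg, mult_INR, Rpow_mult_distr, Rinv_mult, RtoC_mult; ring. }
  apply is_cseries_multiples in HM; [|exact HP0].
  exists (E + - (c * E))%C; split.
  + apply sfg_add; [exact HE|apply sfg_opp, sfg_mul; assumption].
  + replace ((E + - (c * E)) * L)%C with (E * L + Copp 1 * (c * (E * L)))%C by ring.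
    apply is_cseries_ext with (2 := is_cseries_plus _ _ _ _ HS
      (is_cseries_scal (Copp 1) _ _ HM)).
    intros k; rewrite HP; unfold dseries_term.
    change (sieve (p :: l) f (Z.of_nat (S k))) with
      (if Zdivide_dec p (Z.of_nat (S k)) then RtoC 0 else g (Z.of_nat (S k))).
    destruct (Zdivide_dec p (Z.of_nat (S k))); ring.
Qed.

(** * Reduction to the primitive character *)

Lemma prime_divisor_exists (k : Z) : (1 < k)%Z -> exists p, prime p /\ (p | k)%Z.
Proof.
intros Hk; assert (H0 : (0 <= k)%Z) by lia; revert k H0 Hk.
apply (Z_lt_induction (fun k => 1 < k -> exists p, prime p /\ (p | k))%Z).
intros k IH Hk; destruct (prime_dec k) as [Hp|Hp].
- exists k; split; [exact Hp|apply Z.divide_refl].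
- destruct (not_prime_divide k Hk Hp) as [q [Hq Hqk]].
  destruct (IH q) as [p [Hpp Hpq]]; [lia|lia|].
  exists p; split; [exact Hpp|apply Z.divide_trans with q; assumption].
Qed.

Lemma prime_list_exists (m : nat) : (0 < m)%nat -> exists l : list Z,
  (forall p, In p l -> prime p) /\
  (forall k, Z.gcd k (Z.of_nat m) = 1%Z <-> forall p, In p l -> ~ (p | k)%Z).
Proof.
intros Hm.
set (l := filter (fun p => if prime_dec p then
  if Zdivide_dec p (Z.of_nat m) then true else false else false)
  (map Z.of_nat (seq 0 (S m)))).
assert (Hl : forall p, In p l <-> prime p /\ (p | Z.of_nat m)%Z).
{ intros p; unfold l; rewrite filter_In, in_map_iff; split.
  - intros [_ H]; destruct (prime_dec p); [|discriminate].
    destruct (Zdivide_dec p (Z.of_nat m)); [auto|discriminate].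
  - intros [Hp Hd]; assert (H2 := prime_ge_2 p Hp).
    assert (Hle := Z.divide_pos_le p (Z.of_nat m) ltac:(lia) Hd).
    split.
    + exists (Z.to_nat p); split; [lia|apply in_seq; lia].
    + destruct (prime_dec p); [|contradiction].
      destruct (Zdivide_dec p (Z.of_nat m)); [reflexivity|contradiction]. }
exists l; split; [intros p Hp; apply Hl, Hp|].
intros k; split.
- intros Hg p Hp Hk; apply Hl in Hp; destruct Hp as [Hp Hpm].
  assert (H1 := Z.gcd_greatest _ _ _ Hk Hpm); rewrite Hg in H1.
  apply Z.divide_1_r_nonneg in H1; [|assert (H2 := prime_ge_2 p Hp); lia].
  subst p; exact (not_prime_1 Hp).
- intros H; assert (Hg := Z.gcd_nonneg k (Z.of_nat m)).
  destruct (Z.eq_dec (Z.gcd k (Z.of_nat m)) 1) as [E|E]; [exact E|exfalso].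
  assert (Hg0 : Z.gcd k (Z.of_nat m) <> 0%Z).
  { intros E0; apply Z.gcd_eq_0_r in E0; lia. }
  destruct (prime_divisor_exists (Z.gcd k (Z.of_nat m))) as [p [Hp Hpg]]; [lia|].
  apply (H p).
  + apply Hl; split; [exact Hp|].
    apply Z.divide_trans with (1 := Hpg), Z.gcd_divide_r.
  + apply Z.divide_trans with (1 := Hpg), Z.gcd_divide_l.
Qed.

(* [t] is the product of the primes of [l] that do not divide [k]. *)
Lemma coprime_shift (l : list Z) (k m1 : Z) :
  (forall p, In p l -> prime p) -> Z.gcd k m1 = 1%Z ->
  exists t, forall p, In p l -> ~ (p | k + m1 * t)%Z.
Proof.
intros Hl Hg.
assert (Ht : exists t, (forall q, prime q -> (q | k)%Z -> ~ (q | t)%Z) /\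
  forall p, In p l -> ~ (p | k)%Z -> (p | t)%Z).
{ induction l as [|p l IH].
  - exists 1%Z; split; [|intros p []].
    intros q Hq _ H1; apply Z.divide_1_r_nonneg in H1;
      [|assert (H2 := prime_ge_2 q Hq); lia].
    subst q; exact (not_prime_1 Hq).
  - destruct IH as [t [Ht1 Ht2]]; [intros q Hq; apply Hl; right; exact Hq|].
    destruct (Zdivide_dec p k) as [Hp|Hp].
    + exists t; split; [exact Ht1|].
      intros q [<-|Hq] Hqk; [contradiction|auto].
    + exists (p * t)%Z; split.
      * intros q Hq Hqk Hqt; destruct (prime_mult q Hq _ _ Hqt) as [H1|H1];
          [|exact (Ht1 q Hq Hqk H1)].
        assert (Hpp := Hl p (or_introl eq_refl)).
        assert (H2 := prime_ge_2 q Hq); assert (H3 := prime_ge_2 p Hpp).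
        destruct (prime_divisors p Hpp q H1) as [E|[E|[E|E]]]; try lia.
        subst q; contradiction.
      * intros q [<-|Hq] Hqk; [apply Z.divide_factor_l|].
        apply Z.divide_mul_r; auto. }
(* For each prime [p] of the list exactly one of [k] and [m1 * t] is divisible by [p], so their sum
   is not. *)
destruct Ht as [t [Ht1 Ht2]]; exists t; intros p Hp Hd.
assert (Hpp := Hl p Hp); destruct (Zdivide_dec p k) as [Hk|Hk].
- assert (Hm : (p | m1 * t)%Z) by (apply (Z.divide_add_cancel_r _ k); assumption).
  destruct (prime_mult p Hpp _ _ Hm) as [H1|H1]; [|exact (Ht1 p Hpp Hk H1)].
  assert (H2 := Z.gcd_greatest _ _ _ Hk H1); rewrite Hg in H2.
  apply Z.divide_1_r_nonneg in H2; [|assert (H3 := prime_ge_2 p Hpp); lia].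
  subst p; exact (not_prime_1 Hpp).
- apply Hk, (Z.divide_add_cancel_r p (m1 * t)).
  + apply Z.divide_mul_r; auto.
  + rewrite Z.add_comm; exact Hd.
Qed.

Lemma dchar_zero {m} (chi : DirichletChar m) (k : Z) :
  Z.gcd k (Z.of_nat m) <> 1%Z -> chi k = 0%C.
Proof.
intros H; apply NNPP; intros Hn; exact (H (proj1 (dchar_supp _ chi k) Hn)).
Qed.

(** At an integer prime to [m1] but not to [m] the two characters differ. A shift by a multiple of
    [m1] keeps the value of [chi1] and reaches an integer prime to [m], where they agree. *)
Lemma induced_values {m m1} (chi : DirichletChar m) (chi1 : DirichletChar m1) :
  induces chi1 chi -> forall k, chi1 k = 0%C \/ exists j, chi1 k = chi j.
Proof.
intros [_ Hind] k; destruct (Z.eq_dec (Z.gcd k (Z.of_nat m1)) 1) as [Hg|Hg];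
  [right|left; apply dchar_zero, Hg].
destruct (prime_list_exists m (dchar_pos _ chi)) as [l [Hl1 Hl2]].
destruct (coprime_shift l k (Z.of_nat m1) Hl1 Hg) as [t Ht].
exists (k + Z.of_nat m1 * t)%Z; rewrite Hind by (apply Hl2, Ht).
rewrite Z.mul_comm; symmetry; apply periodic_mult, dchar_periodic.
Qed.

Lemma sieve_notin l f k : (forall p, In p l -> ~ (p | k)%Z) -> sieve l f k = f k.
Proof.
intros H; induction l as [|p l IH]; simpl; [reflexivity|].
destruct (Zdivide_dec p k) as [Hd|_]; [exfalso; apply (H p); simpl; auto|].
apply IH; intros q Hq; apply H; right; exact Hq.
Qed.

Lemma sieve_in l f k p : In p l -> (p | k)%Z -> sieve l f k = 0%C.
Proof.
intros Hp Hk; induction l as [|q l IH]; [destruct Hp|]; simpl.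
destruct (Zdivide_dec q k) as [_|Hq]; [reflexivity|].
destruct Hp as [->|Hp]; [contradiction|auto].
Qed.

Lemma induced_sieve {m m1} (chi : DirichletChar m) (chi1 : DirichletChar m1) l :
  induces chi1 chi ->
  (forall k, Z.gcd k (Z.of_nat m) = 1%Z <-> forall p, In p l -> ~ (p | k)%Z) ->
  forall k, chi k = sieve l chi1 k.
Proof.
intros [_ Hind] Hl k; destruct (Z.eq_dec (Z.gcd k (Z.of_nat m)) 1) as [Hg|Hg].
- rewrite Hind by exact Hg; symmetry; apply sieve_notin, Hl, Hg.
- rewrite dchar_zero by exact Hg; symmetry; apply NNPP; intros Hn.
  apply Hg, Hl; intros p Hp Hk; apply Hn; exact (sieve_in l chi1 k p Hp Hk).
Qed.

Lemma Cexp_power (k s : nat) : (0 < k)%nat ->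
  Cexp (- RtoC (INR s) * RtoC (ln (INR k)))%C = RtoC (/ INR k ^ s).
Proof.
intros Hk; apply lt_0_INR in Hk.
rewrite <- RtoC_opp, <- RtoC_mult, Cexp_RtoC; f_equal.
rewrite <- Ropp_mult_distr_l, exp_Ropp, <- exp_pow_INR, exp_ln by exact Hk; reflexivity.
Qed.

Lemma exponential_period_csum (K : C -> Prop) (f : nat -> C) (n : nat) :
  (0 < n)%nat ->
  (forall p, (1 <= p <= n)%nat -> exponential_period (mero_field_gen K) (f p)) ->
  exponential_period (mero_field_gen K) (csum f n).
Proof.
intros Hn H; induction n as [|n IH]; [lia|]; simpl.
destruct (Nat.eq_dec n 0) as [->|Hn0].
- simpl; rewrite Cplus_0_l; apply H; lia.
- apply exponential_period_plus; [apply IH; [lia|intros; apply H; lia]|apply H; lia].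
Qed.

Theorem theorem1p22 :
  forall (m m1 : nat) (chi : DirichletChar m) (chi1 : DirichletChar m1)
    (a n : nat) (zeta : C),
    is_primitive chi1 ->
    induces chi1 chi ->
    (a = 0%nat \/ a = 1%nat) ->
    chi (-1)%Z = Cpow (RtoC (-1)) a ->
    (1 <= n)%nat ->
    (n mod 2 = a mod 2)%nat ->
    primitive_root_of_unity (4 * m1) zeta ->
    exponential_period
      (mero_field_gen
        (subfield_gen (fun z : C => (exists k : Z, z = chi k) \/ z = zeta)))
      (Cdiv (L_series chi (RtoC (INR (n + 1)))) (Cpow (RtoC PI) n)).
Proof.
intros m m1 chi chi1 a n zeta _ Hind Ha Hpar Hn Hna Hz.
set (A := fun z : C => (exists k : Z, z = chi k) \/ z = zeta).
assert (HM := dchar_pos _ chi1); assert (HM' := lt_0_INR _ HM).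
assert (Hval : forall k, subfield_gen A (chi1 k)).
{ intros k; destruct (induced_values chi chi1 Hind k) as [->|[j ->]];
    [apply sfg_zero|apply sfg_mem; left; exists j; reflexivity]. }
(* Since [-1] is prime to [m], [chi1] inherits the parity of [chi], which is that of [n]. *)
assert (Hpar1 : forall k, chi1 (- k)%Z =
  (RtoC (if Nat.even n then 1 else -1) * chi1 k)%C).
{ intros k; replace (- k)%Z with (-1 * k)%Z by lia; rewrite dchar_mult; f_equal.
  rewrite <- (proj2 Hind), Hpar by (change (-1)%Z with (Z.opp 1); rewrite Z.gcd_opp_l; apply Z.gcd_1_l).
  assert (Hev : Nat.even n = Nat.even a).
  { rewrite (Nat.div_mod_eq n 2), (Nat.div_mod_eq a 2), Hna.
    rewrite !(Nat.add_comm (2 * _)), !Nat.even_add_mul_2; reflexivity. }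
  rewrite Hev; destruct Ha as [-> | ->]; simpl; [reflexivity|ring]. }
set (cf := fun p => fourier_coef chi1 n m1 p).
assert (Hcf : forall p, subfield_gen A (cf p)).
{ intros p; apply sfg_csum; intros s; apply sfg_mul; [apply Hval|].
  apply sfg_Rmult; [|apply sfg_Rinv; [lra|apply sfg_INR]].
  (* [sfg_csum] asks for every [s], including [0], where [S (pred s)] is not [s]. *)
  destruct (sfg_cos_sin A m1 (p * S (pred s)) zeta HM Hz (or_intror eq_refl)) as [H1 H2].
  rewrite mult_INR in H1, H2.
  replace (INR p / INR m1 * ang (pred s)) with
    (2 * PI * (INR p * INR (S (pred s))) / INR m1) by (unfold ang; field; lra).
  unfold trig; destruct (Nat.even n); assumption. }
assert (HL : is_cseries (fun k => dseries_term chi1 (n + 1) (S k))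
  (csum (fun p => cf p * RtoC (trig_series n m1 p))%C m1)).
{ apply is_cseries_ext with (fun k => csum (fun p => cf p *
    RtoC (trig n (INR p / INR m1 * ang k) * / INR (S k) ^ (n + 1)))%C m1).
  - intros k; unfold dseries_term.
    rewrite (fourier_expansion chi1 n m1 k HM (dchar_periodic _ chi1) Hpar1).
    rewrite Cmult_comm, <- csum_scal; apply csum_ext_loc; intros p _.
    unfold cf; rewrite RtoC_mult; ring.
  - apply is_cseries_csum; intros p _.
    apply is_cseries_scal, is_cseries_RtoC, ex_trig_series, Hn. }
(* All primes dividing [m] are sieved out; at those dividing [m1] the Euler factor is [1], because
   [chi1] vanishes there. *)
destruct (prime_list_exists m (dchar_pos _ chi)) as [l [Hl1 Hl2]].
destruct (euler_factors A chi1 (n + 1) _ l Hl1 (dchar_mult _ chi1) Hval HL) as [E [HE HS]].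
assert (HLs : L_series chi (RtoC (INR (n + 1))) =
  (E * csum (fun p => cf p * RtoC (trig_series n m1 p)) m1)%C).
{ apply is_cseries_CSeries, is_cseries_ext with (2 := HS).
  intros k; unfold dseries_term.
  rewrite Cexp_power, (induced_sieve chi chi1 l Hind Hl2) by lia; reflexivity. }
rewrite HLs; unfold Cdiv.
replace (E * csum (fun p => cf p * RtoC (trig_series n m1 p)) m1 * / Cpow (RtoC PI) n)%C
  with (csum (fun p => E * cf p * RtoC (trig_series n m1 p / PI ^ n))%C m1).
- apply exponential_period_csum; [exact HM|].
  intros p Hp; apply exponential_period_trig_series; try assumption; [lia|].
  apply sfg_mul; [exact HE|apply Hcf].
- assert (HPI : PI ^ n <> 0) by (apply pow_nonzero, PI_neq0).
  rewrite <- RtoC_pow, <- RtoC_inv by exact HPI.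
  rewrite (Cmult_comm _ (RtoC _)), <- csum_scal, <- csum_scal.
  apply csum_ext_loc; intros p _; unfold Rdiv; rewrite RtoC_mult; ring.
Qed.
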